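(* Let $n,k,k_1,\dots,k_n\ge1$, let $A_j$ be a real $k\times k_j$ matrix for $j=1,\dots,n$, and let $A=(A_1,\dots,A_n)$, a $k\times(k_1+\dots+k_n)$ matrix. Let $\Omega\subset\mathbb{R}^n$ be a rectangular domain (a product of $n$ intervals) and let $B:\Omega\to\mathbb{R}$ be smooth. Let $C\ge0$ be a symmetric positive semidefinite $k\times k$ matrix with $A_j^*CA_j>0$ for all $j$. Let $u_j:\mathbb{R}^{k_j}\to\mathbb{R}$ be smooth compactly supported functions such that $\vec u(x)=(u_1(xA_1),\dots,u_n(xA_n))$ maps $\mathbb{R}^k$ into $\Omega$. Let $T=(B_1A_1,\dots,B_nA_n)$, where $B_j=\partial_jB$ (a $k\times(k_1+\dots+k_n)$ matrix depending on the point of $\Omega$). Assume that $$P_{\ker T}\,(A^*CA\bullet\mathrm{Hess}\,B)\,P_{\ker T}\le0\quad\text{on }\Omega,$$ and that the following condition at infinity holds: $$\liminf_{|x|\to\infty}\ \inf_{u_j}\ B\left(\frac{u_1}{1+|xA_1|},\dots,\frac{u_n}{1+|xA_n|}\right)\ge0,$$ where the infimum is over all real numbers $u_1,\dots,u_n$ with $u_j$ in the range of the function $u_j(\cdot)$. If $B((P_t^C\vec u)(x))\ge0$ for $t=0$ and all $x\in\mathbb{R}^k$, then $B((P_t^C\vec u)(x))\ge0$ for all $t\ge0$ and all $x\in\mathbb{R}^k$.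
   Context: Elements $x\in\mathbb{R}^k$ are written as row vectors, so $xA_j\in\mathbb{R}^{k_j}$. $A^*CA\bullet\mathrm{Hess}\,B$ denotes the $(\sum_jk_j)\times(\sum_jk_j)$ block matrix $\{A_i^*CA_j\,\partial_{ij}B\}_{i,j=1}^n$, whose $(i,j)$ block is the $k_i\times k_j$ matrix $A_i^*CA_j$ multiplied by the scalar $\partial_{ij}B$. $P_{\ker T}$ is the orthogonal projection of $\mathbb{R}^{k_1+\dots+k_n}$ onto $\ker T$. $M\le0$ means negative semidefinite. $P_t^C\vec u$ is defined componentwise: its $j$-th component is $$\int_{\mathbb{R}^{k_j}}u_j\big(xA_j+(2tA_j^*CA_j)^{1/2}y\big)\,d\gamma_{k_j}(y),$$ with $\gamma_{k_j}$ the standard Gaussian measure on $\mathbb{R}^{k_j}$; equivalently it is $U_j(xA_j,t)$ where $\partial_tU_j=\sum_{p,q}(A_j^*CA_j)_{pq}\,\partial_{y_p}\partial_{y_q}U_j$ and $U_j(\cdot,0)=u_j$. *)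

(* Defs.v *)
From HB Require Import structures.
From mathcomp Require Import all_boot all_order all_algebra.
From mathcomp Require Import all_classical all_reals all_analysis.

Set Implicit Arguments.
Unset Strict Implicit.
Unset Printing Implicit Defensive.

Import Order.TTheory GRing.Theory Num.Theory.
Import numFieldNormedType.Exports.

Local Open Scope classical_set_scope.
Local Open Scope ring_scope.

Section linear_algebra.
Context {R : realType}.

(* The Euclidean norm; `|x| is the max norm on 'rV[R]_n. *)
Definition enorm n (x : 'rV[R]_n) : R := Num.sqrt (\sum_i x 0 i ^+ 2).

Definition psdmx n (M : 'M[R]_n) : Prop :=
  M^T = M /\ forall v : 'rV_n, 0 <= (v *m M *m v^T) 0 0.

Definition pdmx n (M : 'M[R]_n) : Prop :=
  M^T = M /\ forall v : 'rV_n, v != 0 -> 0 < (v *m M *m v^T) 0 0.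

Definition nsdmx n (M : 'M[R]_n) : Prop := psdmx (- M).

(* The (unique) positive semidefinite square root, for psdmx M. *)
Definition sqrtmx n (M : 'M[R]_n) : 'M[R]_n :=
  xget 0 [set S | psdmx S /\ S *m S = M].

(* Orthogonal projection of R^n onto the row space of U: the rows of
   kermx U^T span the vectors orthogonal to all rows of U. *)
Definition orthoproj m n (U : 'M[R]_(m, n)) : 'M[R]_n :=
  proj_mx <<U>>%MS (kermx U^T).

(* Orthogonal projection onto ker T = {v | T v = 0}, T acting on columns: the
   rows of kermx T^T span the transposes of these v. *)
Definition proj_ker m n (T : 'M[R]_(m, n)) : 'M[R]_n := orthoproj (kermx T^T).

End linear_algebra.

Section smoothness.
Context {R : realType}.

Definition partial n (i : 'I_n) (f : 'rV[R]_n -> R) : 'rV[R]_n -> R :=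
  fun x => 'D_(delta_mx 0 i) f x.

Definition partials n (s : seq 'I_n) (f : 'rV[R]_n -> R) : 'rV[R]_n -> R :=
  foldr (@partial n) f s.

(* C^oo on a set D that need not be open: all iterated partial derivatives
   exist and are continuous on an open neighborhood of D. *)
Definition smooth_on n (D : set 'rV[R]_n) (f : 'rV[R]_n -> R) : Prop :=
  exists U : set 'rV[R]_n, [/\ open U, D `<=` U &
    forall (s : seq 'I_n) (x : 'rV[R]_n), U x ->
      {for x, continuous (partials s f)} /\
      forall i, derivable (partials s f) x (delta_mx 0 i)].

Definition compactly_supported n (f : 'rV[R]_n -> R) : Prop :=
  compact (closure [set x | f x != 0]).

Definition box n (I : 'I_n -> interval R) : set 'rV[R]_n :=
  [set v | forall j, v 0 j \in I j].

Definition at_infty n : set_system 'rV[R]_n :=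
  filter_from [set: R] (fun M => [set x | M < enorm x]).

End smoothness.

Section gaussian.
Context {R : realType}.

Definition cons_pair n (p : measurableTypeR R * n.-tuple (measurableTypeR R)) :
  n.+1.-tuple (measurableTypeR R) := [the n.+1.-tuple _ of p.1 :: p.2].

Let measurable_cons_pair n : measurable_fun setT (@cons_pair n).
Proof. exact: measurable_cons. Qed.

HB.instance Definition _ n :=
  isMeasurableFun.Build _ _ _ _ (@cons_pair n) (@measurable_cons_pair n).

(* The standard Gaussian measure on R^n, as the n-fold product of N(0, 1); the
   library puts a measurable structure on n.-tuple R rather than on 'rV[R]_n. *)
Fixpoint gauss n : probability (n.-tuple (measurableTypeR R)) R :=
  match n with
  | 0 => \d_ [tuple]
  | n'.+1 => distribution
      ((normal_prob 0 1 : probability (measurableTypeR R) R) \x gauss n')%E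
      (@cons_pair n')
  end.

Definition row_of_tuple n (y : n.-tuple (measurableTypeR R)) : 'rV[R]_n :=
  \row_i tnth y i.

End gaussian.

Section flow.
Context {R : realType} {n k : nat} {d : 'I_n -> nat}.
Variables (A : forall j, 'M[R]_(k, d j)) (C : 'M[R]_k).

(* The square root is symmetric, so that it may act on the right of the row
   vector y. *)
Definition heat_flow (u : forall j, 'rV[R]_(d j) -> R) (t : R) (x : 'rV[R]_k) :
    'rV[R]_n :=
  \row_j \int[gauss (d j)]_y
    u j (x *m A j + row_of_tuple y *m sqrtmx (2 * t *: ((A j)^T *m C *m A j))).

Definition hess_form (B : 'rV[R]_n -> R) (v : 'rV[R]_n) :
    'M[R]_(\sum_j d j, \sum_j d j) :=
  \mxblock_(i, j) (partial i (partial j B) v *: ((A i)^T *m C *m A j)).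

Definition grad_mx (B : 'rV[R]_n -> R) (v : 'rV[R]_n) : 'M[R]_(k, \sum_j d j) :=
  \mxrow_j (partial j B v *: A j).

Definition damped_inf (B : 'rV[R]_n -> R) (u : forall j, 'rV[R]_(d j) -> R)
    (x : 'rV[R]_k) : \bar R :=
  ereal_inf [set (B (\row_j (w 0 j / (1 + enorm (x *m A j)))))%:E |
             w in [set w : 'rV[R]_n | forall j, range (u j) (w 0 j)]].

End flow.

(* Main.v *)
(* Take s = sqrt(2 t) as the time variable, so that P_t u = phi s with
   phi_j(x, s) = E u_j(x A_j + s Y (A_j^T C A_j)^(1/2)), Y standard Gaussian; Gaussian
   integration by parts gives d/ds phi_j = s (A_j^T C A_j . Hess phi_j).
   Suppose B(phi) < 0 at some time s1 and let e > 0 be small. Then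
   B(phi(x, s)) + e s has a negative minimum over R^k x [0, s1], attained at some
   (x0, s0) with s0 > 0. There the x-gradient of B(phi) vanishes, which says that
   w = (grad phi_j)_j lies in ker T, so (A^T C A . Hess B) w . w <= 0; since the
   second derivatives of B(phi) along the rows of C^(1/2) are nonnegative,
   d/ds B(phi) >= 0, whereas minimality in s forces d/ds B(phi) + e <= 0.
   The minimum exists because liminf B(phi(x, s)) >= 0 as x -> oo, uniformly for s in
   [0, s1]. Where |x A_j| is large, phi_j decays faster than 1 / (1 + |x A_j|), hence is
   of the form w_j / (1 + |x A_j|) with w_j in the range of u_j; the remaining indices,
   for which x A_j stays bounded, are handled by moving x by a bounded amount to a point
   x' with x' A_j = 0, at which the damping factor of the condition at infinity is 1. *)

Require Import Defs.
From HB Require Import structures.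
From mathcomp Require Import all_boot all_order all_algebra.
From mathcomp Require Import complex.
From mathcomp Require Import all_classical all_reals all_analysis.
From mathcomp Require Import measurable_realfun ring lra.

Set Implicit Arguments.
Unset Strict Implicit.
Unset Printing Implicit Defensive.

Import Order.TTheory GRing.Theory Num.Theory.
Import numFieldNormedType.Exports.

Local Open Scope classical_set_scope.
Local Open Scope ring_scope.

(** * Row vectors *)

Section row_norm.
Context {R : realType}.

Lemma rV_norm_coord n (x : 'rV[R]_n) j : `|x 0 j| <= `|x|.
Proof.
by rewrite [leRHS]mx_normrE; apply: (le_bigmax _ (fun ij => `|x ij.1 ij.2|) (0, j)).
Qed.

Lemma rV_norm_le n (x : 'rV[R]_n) e :
  0 <= e -> (forall j, `|x 0 j| <= e) -> `|x| <= e.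
Proof.
move=> e0 xe; rewrite [leLHS]mx_normrE; apply: bigmax_le => // -[i j] _ /=.
by rewrite ord1.
Qed.

Lemma mulmx_norm_le m n (A : 'M[R]_(m, n)) :
  exists2 K, 0 <= K & forall x : 'rV[R]_m, `|x *m A| <= K * `|x|.
Proof.
exists (\sum_i \sum_j `|A i j|); first by do 2 apply: sumr_ge0 => ? _.
have K0 : 0 <= \sum_i \sum_j `|A i j| by do 2 apply: sumr_ge0 => ? _.
move=> x; apply: rV_norm_le => [|j]; first by rewrite mulr_ge0.
rewrite mxE (le_trans (ler_norm_sum _ _ _))// mulr_suml ler_sum// => i _.
rewrite normrM mulrC ler_pM ?rV_norm_coord// (bigD1 j)//= lerDl.
by apply: sumr_ge0 => ? _.
Qed.

Lemma enorm_ge0 n (x : 'rV[R]_n) : 0 <= enorm x.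
Proof. exact: sqrtr_ge0. Qed.

Lemma norm_le_enorm n (x : 'rV[R]_n) : `|x| <= enorm x.
Proof.
apply: rV_norm_le => [|j]; first exact: enorm_ge0.
rewrite -(sqrtr_sqr (x 0 j)) ler_wsqrtr// (bigD1 j)//= lerDl.
by apply: sumr_ge0 => i _; exact: sqr_ge0.
Qed.

Lemma enorm_le_norm n (x : 'rV[R]_n) : enorm x <= n%:R * `|x|.
Proof.
have nx0 : 0 <= n%:R * `|x| by rewrite mulr_ge0.
rewrite -(ger0_norm nx0) -sqrtr_sqr ler_wsqrtr//.
rewrite (le_trans (_ : _ <= \sum_(i < n) `|x| ^+ 2))//.
  apply: ler_sum => i _; rewrite -(real_normK (num_real (x 0 i))).
  by rewrite ler_pXn2r// ?nnegrE// rV_norm_coord.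
rewrite sumr_const card_ord exprMn -[leLHS]mulr_natl ler_wpM2r ?exprn_ge0//.
by rewrite -natrX ler_nat -mulnn; case: n {x nx0} => // n; rewrite leq_pmulr.
Qed.

Lemma cvg_row (T : Type) (F : set_system T) n (f : T -> 'rV[R]_n) (l : 'rV[R]_n) :
  Filter F -> (forall j, (fun t => f t 0 j) @ F --> l 0 j) -> f @ F --> l.
Proof.
move=> FF fl; apply/cvgrPdist_le => e e0.
have : \forall t \near F, forall j : 'I_n, `|l 0 j - f t 0 j| <= e.
  apply: filter_forall => j; have /cvgrPdist_le := fl j; exact.
apply: filterS => t ft; apply: rV_norm_le => [|j]; first exact: ltW.
by rewrite !mxE.
Qed.

Lemma continuous_mulmxr m n (A : 'M[R]_(m, n)) :
  continuous (fun x : 'rV[R]_m => x *m A).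
Proof.
have [K K0 AK] := mulmx_norm_le A.
move=> x; apply/(@cvgrPdist_le _ _ _ (nbhs x)) => e e0; near=> y.
rewrite -mulmxBl (le_trans (AK _))//.
have K1 : 0 < K + 1 by rewrite ltr_wpDl.
rewrite (@le_trans _ _ ((K + 1) * `|x - y|))// ?ler_wpM2r ?lerDl//.
rewrite -ler_pdivlMl//; near: y; apply: cvgr_dist_le => //.
by rewrite mulr_gt0// invr_gt0 ltr_wpDl.
Unshelve. all: end_near. Qed.

End row_norm.

(** * Measurability of continuous functions of a tuple *)

Section tuple_measurability.
Context {R : realType}.

(* f is the pointwise limit of the functions obtained by rounding every
   coordinate down to a multiple of 1/(m+1), which take countably many values. *)
Lemma continuous_measurable_row n (f : 'rV[R]_n -> R) : continuous f ->
  measurable_fun setT (fun Y : n.-tuple (measurableTypeR R) => f (row_of_tuple Y)).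
Proof.
move=> cf.
pose r (m : nat) (z : {ffun 'I_n -> int}) : 'rV[R]_n :=
  \row_i ((z i)%:~R / m.+1%:R).
pose fl (m : nat) (Y : n.-tuple (measurableTypeR R)) : {ffun 'I_n -> int} :=
  [ffun i => Num.floor (m.+1%:R * (tnth Y i : R))].
apply: (@measurable_fun_cvg _ _ _ _ (fun m Y => f (r m (fl m Y)))).
  move=> m _ B mB; rewrite setTI.
  pose F (z : {ffun 'I_n -> int}) : set (n.-tuple (measurableTypeR R)) :=
    if `[<B (f (r m z))>] then [set Y | forall i, fl m Y i = z i] else set0.
  rewrite (_ : _ @^-1` _ = \bigcup_z F z); last first.
    apply/seteqP; split => [Y BY|Y [z _]].
      by exists (fl m Y) => //; rewrite /F; case: asboolP.
    rewrite /F; case: asboolP => // Bz /= Yz.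
    by rewrite (_ : fl m Y = z)//; apply/ffunP.
  apply: countable_bigcupT_measurable => // z.
  rewrite /F; case: asboolP => // _.
  rewrite (_ : mkset _ = \bigcap_(i in [set: 'I_n]) [set Y | fl m Y i = z i]); last first.
    by apply/seteqP; split => [Y Yz i _|Y Yz i]; exact: Yz.
  apply: fin_bigcap_measurable => // i _.
  rewrite (_ : mkset _ = (fun Y : n.-tuple (measurableTypeR R) => (tnth Y i : R)) @^-1`
    `[(z i)%:~R / m.+1%:R, (z i + 1)%:~R / m.+1%:R[%classic); last first.
    apply/seteqP; split => [Y /=|Y /=]; rewrite ffunE in_itv/=.
      move=> /eqP; rewrite floor_eq ler_pdivrMr ?ltr0n// ltr_pdivlMr ?ltr0n//.
      by rewrite (mulrC (tnth _ _)).
    rewrite ler_pdivrMr ?ltr0n// ltr_pdivlMr ?ltr0n// (mulrC (tnth _ _)) => h.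
    by apply/eqP; rewrite floor_eq.
  have := @measurable_tnth _ (measurableTypeR R) n i measurableT
    `[(z i)%:~R / m.+1%:R, (z i + 1)%:~R / m.+1%:R[%classic.
  by rewrite setTI; apply; exact: measurable_itv.
move=> Y _; suff rY : (fun m => r m (fl m Y)) @ \oo --> row_of_tuple Y.
  exact: cvg_comp rY (cf _).
apply: cvg_row => j; apply/cvgrPdist_le => e e0; near=> m.
rewrite !mxE ffunE.
have m0 : 0 < m.+1%:R :> R by rewrite ltr0n.
have /andP[h1 h2] := floor_itv (m.+1%:R * (tnth Y j : R)).
rewrite ger0_norm; last by rewrite subr_ge0 ler_pdivrMr// [leRHS]mulrC.
have me : m.+1%:R^-1 <= e.
  by apply: ltW; near: m; exact: (near_infty_natSinv_lt (PosNum e0)).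
rewrite (le_trans _ me)// lerBlDr -[X in _ <= X + _]div1r -mulrDl ler_pdivlMr//.
rewrite [leLHS]mulrC ltW//.
by rewrite (lt_le_trans h2)// intrD addrC.
Unshelve. all: end_near. Qed.

End tuple_measurability.

(** * Positive semidefinite matrices and orthogonal projections *)

Section psd.
Context {R : realType}.

Lemma mulmx_trr_eq0 m n (v : 'M[R]_(m, n)) : v *m v^T = 0 -> v = 0.
Proof.
move=> /matrixP v0; apply/matrixP => i j; have := v0 i i; rewrite !mxE => /eqP.
rewrite psumr_eq0; last by move=> l _; rewrite mxE -expr2 sqr_ge0.
by move=> /allP /(_ j (mem_index_enum _)); rewrite !mxE mulf_eq0 orbb => /eqP.
Qed.

Lemma row_mul_tr_ge0 n (v : 'rV[R]_n) : 0 <= (v *m v^T) 0 0.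
Proof. by rewrite mxE sumr_ge0// => i _; rewrite mxE -expr2 sqr_ge0. Qed.

Lemma row_mul_tr_gt0 n (v : 'rV[R]_n) : v != 0 -> 0 < (v *m v^T) 0 0.
Proof.
move=> v0; rewrite lt_def row_mul_tr_ge0 andbT; apply: contra v0 => /eqP vv.
apply/eqP/mulmx_trr_eq0/matrixP => i j.
by rewrite !ord1 vv mxE.
Qed.

Lemma horner_mx_tr n (M : 'M[R]_n.+1) (p : {poly R}) :
  (horner_mx M p)^T = horner_mx M^T p.
Proof.
elim/poly_ind: p => [|p c IH]; first by rewrite !rmorph0 trmx0.
rewrite !(rmorphD, rmorphM)/= !horner_mx_X !horner_mx_C linearD/= -!mulmxE.
rewrite trmx_mul tr_scalar_mx IH; congr (_ + _).
have -> : M^T *m horner_mx M^T p = horner_mx M^T ('X * p).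
  by rewrite rmorphM/= horner_mx_X.
by rewrite mulrC rmorphM/= horner_mx_X.
Qed.

(** Newton's scheme: a new node [a] is corrected by a multiple of the product [q] of the [X - b]
    over the earlier nodes, which leaves their values unchanged. Values are prescribed by a
    function, so repeated nodes, here repeated eigenvalues, cause no conflict. *)
Lemma poly_interpolation (F : fieldType) (s : seq F) (f : F -> F) :
  exists p : {poly F}, forall x, x \in s -> p.[x] = f x.
Proof.
elim: s => [|a s [p IH]]; first by exists 0.
have [as_|nas] := boolP (a \in s).
  by exists p => x; rewrite inE => /orP[/eqP ->|]; exact: IH.
pose q := \prod_(b <- s) ('X - b%:P).
have qa : q.[a] != 0 by rewrite -[_ == 0]/(root q a) root_prod_XsubC.
exists (p + ((f a - p.[a]) / q.[a]) *: q) => x.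
rewrite inE !hornerE => /predU1P[->|xs]; first by rewrite divfK// addrC subrK.
have /eqP -> : q.[x] == 0 by rewrite -[_ == 0]/(root q x) root_prod_XsubC.
by rewrite mulr0 addr0 IH.
Qed.

(* M is diagonalised over R[i], with real spectrum l >= 0; S = T * T, where T = r(M)
   for a real polynomial r with r(l) = l^(1/4), is then real, symmetric and psd. *)
Lemma psd_sqrt n (M : 'M[R]_n) : psdmx M ->
  exists S : 'M[R]_n, psdmx S /\ S *m S = M.
Proof.
case: n M => [M _|n M [Msym Mpsd]].
  exists 0; split; last by apply/matrixP => -[].
  by split=> [|v]; rewrite ?trmx0// mulmx0 mul0mx mxE.
pose toC := real_complex R.
pose Mc := map_mx toC M.
have Mherm : Mc \is hermsymmx.
  apply: realsym_hermsym.
    by apply/is_hermitianmxP; rewrite expr0 scale1r map_mx_id// /Mc map_trmx Msym.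
  by apply/mxOverP => i j; rewrite mxE; by apply/complex_realP; exists (M i j).
pose P := spectralmx Mc; pose sp := spectral_diag Mc.
have Pu : P \in unitmx by exact: spectral_unit.
have Mdec : Mc = invmx P *m diag_mx sp *m P.
  by apply/orthomx_spectralP; exact: hermitian_normalmx.
have /mxOverP spreal := hermitian_spectral_diag_real Mherm.
pose l i : R := complex.Re (sp 0 i).
have lE i : sp 0 i = toC (l i).
  by have /RRe_real/esym := spreal 0 i.
(* A real eigenvalue of the complexified matrix is a root of the real characteristic polynomial, so
   it has a real eigenvector [v], on which the positivity of [M] can be tested. *)
have l0 i : 0 <= l i.
  have : eigenvalue Mc (toC (l i)).
    apply/eigenvalueP; exists (row i P).
      rewrite Mdec !mulmxA -row_mul mulmxV// row1 -rowE.
      by rewrite row_diag_mx -scalemxAl -rowE lE.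
    rewrite rowE mulmx_free_eq0 ?row_free_unit//.
    by apply/eqP => /matrixP/(_ 0 i)/eqP; rewrite !mxE !eqxx oner_eq0.
  rewrite eigenvalue_root_char -map_char_poly fmorph_root -eigenvalue_root_char.
  move=> /eigenvalueP[v vM v0].
  have := Mpsd v; rewrite vM -scalemxAl mxE pmulr_lge0//.
  exact: row_mul_tr_gt0.
have [r rE] := poly_interpolation [seq l i | i : 'I_n.+1] (fun x => Num.sqrt (Num.sqrt x)).
pose T := horner_mx M r.
have Tsym : T^T = T by rewrite /T horner_mx_tr Msym.
exists (T *m T); split.
  split; first by rewrite trmx_mul Tsym.
  move=> v; rewrite mulmxA -mulmxA -[X in _ *m (X *m _)]Tsym -trmx_mul.
  exact: row_mul_tr_ge0.
have r4 : horner_mx M (r ^+ 4 - 'X) = 0.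
  apply/eqP; rewrite -(map_mx_eq0 toC) map_horner_mx -/Mc Mdec.
  rewrite horner_mx_uconjC//.
  rewrite horner_mx_diag (_ : map_mx _ sp = 0) ?linear0 ?mulmx0 ?mul0mx//.
  apply/matrixP => a i; rewrite ord1 !mxE lE horner_map/= !hornerE.
  rewrite rE; last by apply/mapP; exists i; rewrite ?mem_enum.
  by rewrite (exprM _ 2 2) !sqr_sqrtr ?sqrtr_ge0// subrr.
have T4 : T *m T *m (T *m T) = horner_mx M (r ^+ 4).
  by rewrite !mulmxE -!rmorphM/= -!expr2 -exprM.
by rewrite T4; move/eqP: r4; rewrite rmorphB/= horner_mx_X subr_eq0 => /eqP.
Qed.

Lemma sqrtmxP n (M : 'M[R]_n) : psdmx M ->
  psdmx (sqrtmx M) /\ sqrtmx M *m sqrtmx M = M.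
Proof.
move=> /psd_sqrt SM.
exact: (@xgetPex _ 0 [set S | psdmx S /\ S *m S = M] SM).
Qed.

(** With [Q] the square root of [S], the number v S v^T is the squared length of v Q, so v Q = 0 and
    hence v S = 0. *)
Lemma psd_isotropic n (S : 'M[R]_n) (v : 'rV[R]_n) :
  psdmx S -> (v *m S *m v^T) 0 0 = 0 -> v *m S = 0.
Proof.
move=> /sqrtmxP[[Qsym _] <-] /=; set Q := sqrtmx S => vQ.
rewrite mulmxA (_ : v *m Q = 0) ?mul0mx//.
apply: mulmx_trr_eq0; apply/matrixP => i j; rewrite !ord1 [RHS]mxE -[RHS]vQ.
by rewrite trmx_mul Qsym !mulmxA.
Qed.

Lemma pdmx_psd n (M : 'M[R]_n) : pdmx M -> psdmx M.
Proof.
move=> [Msym M0]; split=> // v; have [->|/M0/ltW//] := eqVneq v 0.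
by rewrite !mul0mx mxE.
Qed.

Lemma pdmx_sqrt n (S : 'M[R]_n) : psdmx S -> pdmx (S *m S) -> pdmx S.
Proof.
move=> Spsd [_ SSpd]; split=> [|v v0]; first by case: Spsd.
rewrite lt_def (Spsd.2 v) andbT; apply/eqP => vSv.
have vS := psd_isotropic Spsd vSv.
by have := SSpd v v0; rewrite mulmxA vS !mul0mx mxE ltxx.
Qed.

Lemma mxtrace_quad m n (S : 'M[R]_n) (D : 'M[R]_(m, n)) :
  \tr (D *m S *m D^T) = \sum_i (row i D *m S *m (row i D)^T) 0 0.
Proof.
rewrite /mxtrace; apply: eq_bigr => i _.
by rewrite -row_mul [LHS]mxE [RHS]mxE; apply: eq_bigr => j _; rewrite !mxE.
Qed.

(* With D = S - S' one has S D + D S' = S^2 - S'^2 = 0, so the nonnegative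
   traces of D S D and D S' D add up to 0. *)
Lemma pd_sqrt_unique n (S S' : 'M[R]_n) :
  pdmx S -> psdmx S' -> S *m S = S' *m S' -> S = S'.
Proof.
move=> [Ssym Spd] [S'sym S'psd] SS'; apply/eqP; rewrite -subr_eq0.
set D := S - S'; have Dsym : D^T = D by rewrite /D linearB/= Ssym S'sym.
have SD : S *m D + D *m S' = 0.
  by rewrite /D mulmxBr mulmxBl addrA subrK SS' subrr.
have : \tr (D *m S *m D^T) + \tr (D *m S' *m D^T) = 0.
  rewrite Dsym [X in _ + X]mxtrace_mulC -[X in \tr X + _]mulmxA.
  by rewrite -linearD/= -mulmxDr SD mulmx0 mxtrace0.
rewrite !mxtrace_quad => /eqP.
have psum (F : 'M[R]_n) : (forall v : 'rV_n, 0 <= (v *m F *m v^T) 0 0) ->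
  0 <= \sum_i (row i D *m F *m (row i D)^T) 0 0 by move=> F0; apply: sumr_ge0.
have S0 (v : 'rV_n) : 0 <= (v *m S *m v^T) 0 0.
  by have [->|/Spd/ltW//] := eqVneq v 0; rewrite !mul0mx mxE.
rewrite paddr_eq0 ?psum// psumr_eq0// => /andP[/allP D0 _].
apply/eqP/row_matrixP => i; rewrite row0; apply/eqP; apply: contraT => /Spd.
by move/eqP: (D0 i (mem_index_enum _)) => ->; rewrite ltxx.
Qed.

Lemma psdmxZ n (M : 'M[R]_n) (a : R) : 0 <= a -> psdmx M -> psdmx (a *: M).
Proof.
move=> a0 [Msym M0]; split=> [|v]; first by rewrite linearZ/= Msym.
by rewrite -scalemxAr -scalemxAl mxE mulr_ge0.
Qed.

Lemma pdmxZ n (M : 'M[R]_n) (a : R) : 0 < a -> pdmx M -> pdmx (a *: M).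
Proof.
move=> a0 [Msym M0]; split=> [|v v0]; first by rewrite linearZ/= Msym.
by rewrite -scalemxAr -scalemxAl mxE mulr_gt0// M0.
Qed.

(** For s > 0 both sides are psd square roots of s^2 M, which is definite, so uniqueness applies. At
    s = 0 definiteness is lost, but a symmetric matrix with square 0 vanishes. This allows the flow
    to be written with the noise scaled linearly in s = sqrt(2 t). *)
Lemma sqrtmxZ n (M : 'M[R]_n) (s : R) : pdmx M -> 0 <= s ->
  sqrtmx (s ^+ 2 *: M) = s *: sqrtmx M.
Proof.
move=> Mpd; have Mpsd := pdmx_psd Mpd; have [Qpsd QQ] := sqrtmxP Mpsd.
rewrite le_eqVlt => /predU1P[<-|s0].
  rewrite expr0n !scale0r.
  have [[Ssym _] SS] := sqrtmxP (psdmxZ (lexx 0) Mpsd).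
  by rewrite scale0r in Ssym SS; apply: mulmx_trr_eq0; rewrite Ssym.
have [Spsd SS] := sqrtmxP (psdmxZ (sqr_ge0 s) Mpsd).
apply: pd_sqrt_unique; last first.
- by rewrite SS -scalemxAr -scalemxAl QQ scalerA expr2.
- exact: psdmxZ (ltW s0) Qpsd.
- by apply: pdmx_sqrt => //; rewrite SS; apply: pdmxZ => //; rewrite exprn_gt0.
Qed.

End psd.

(** * Orthogonal projections and quadratic forms restricted to a kernel *)

Section orthoproj.
Context {R : realType}.

Lemma capmx_orthogonal m n (U : 'M[R]_(m, n)) : (<<U>> :&: kermx U^T = 0)%MS.
Proof.
apply/eqP; rewrite -submx0; apply/rV_subP => v; rewrite sub_capmx genmxE.
move=> /andP[/submxP[a ->] /sub_kermxP aUU]; rewrite submx0; apply/eqP.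
by apply: mulmx_trr_eq0; rewrite trmx_mul mulmxA aUU mul0mx.
Qed.

Lemma orthoproj_id m n p (U : 'M[R]_(m, n)) (W : 'M[R]_(p, n)) :
  (W <= U)%MS -> W *m orthoproj U = W.
Proof.
by move=> WU; rewrite proj_mx_id ?genmxE//; exact: capmx_orthogonal.
Qed.

(** The rows of P lie in the row space of U and those of 1 - P in its orthogonal complement, so (1 -
    P) P^T = 0. Thus P^T = P P^T, whose right side is symmetric. *)
Lemma tr_orthoproj m n (U : 'M[R]_(m, n)) : (orthoproj U)^T = orthoproj U.
Proof.
set P := orthoproj U.
have PU : (P <= U)%MS.
  by rewrite -[P]mul1mx (submx_trans (proj_mx_sub _ _ _)) ?genmxE.
have P1U : (1%:M - P <= kermx U^T)%MS.
  rewrite -[P]mul1mx /P proj_mx_compl_sub//.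
  (* The row space and its orthogonal complement meet in 0, so their ranks add up to n. *)
  apply: submx_full; rewrite /row_full.
  rewrite (mxdirectP (_ : mxdirect (<<U>> + kermx U^T)))/=; last first.
    by rewrite mxdirect_addsE/= !mxdirectE/= !eqxx capmx_orthogonal eqxx.
  by rewrite mxrank_gen mxrank_ker mxrank_tr subnKC// rank_leq_col.
have : (1%:M - P) *m P^T = 0.
  have /submxP[X PX] := PU; rewrite {2}PX trmx_mul mulmxA.
  by move/sub_kermxP: P1U => ->; rewrite mul0mx.
rewrite mulmxBl mul1mx => /eqP; rewrite subr_eq0 => /eqP PP.
clearbody P.
by have := congr1 trmx PP; rewrite trmx_mul !trmxK -PP => <-.
Qed.

(** A vector of the kernel is fixed by the symmetric projection P, so w P H P w^T = w H w^T. *)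
Lemma proj_ker_quad_le0 m n (T : 'M[R]_(m, n)) (H : 'M[R]_n) (w : 'rV[R]_n) :
  T *m w^T = 0 -> nsdmx (proj_ker T *m H *m proj_ker T) ->
  (w *m H *m w^T) 0 0 <= 0.
Proof.
move=> Tw [_ /(_ w)]; set P := proj_ker T.
have wP : w *m P = w.
  apply: orthoproj_id; apply/sub_kermxP.
  by rewrite -[w]trmxK -trmx_mul Tw trmx0.
have PT : P^T = P by exact: tr_orthoproj.
clearbody P; rewrite mulmxN mulNmx mxE oppr_ge0 !mulmxA wP -[_ *m P *m _]mulmxA.
by rewrite -{1}PT -trmx_mul wP.
Qed.

End orthoproj.

(** * Gaussian integration by parts *)

Section std_normal.
Context {R : realType}.
Notation mu := (@lebesgue_measure R).
Notation N01 := (@normal_prob R 0 1).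
Notation phi := (@normal_pdf R 0 1).

Import HBNNSimple.

(** The usual ladder for a measure with a density: indicators, then simple functions by linearity,
    then monotone limits of simple functions. *)
Lemma ge0_integral_normal_prob (f : _ -> \bar R) :
  measurable_fun setT f ->
  (forall x, 0 <= f x)%E ->
  (\int[N01]_x f x = \int[mu]_x (f x * (phi x)%:E))%E.
Proof.
move=> mf f0.
have phi0 x : (0 <= (phi x)%:E)%E by rewrite lee_fin normal_pdf_ge0.
have mphi : measurable_fun setT (EFin \o phi).
  by apply/measurable_EFinP; exact: measurable_normal_pdf.
have indE E : measurable E ->
    (\int[N01]_x (\1_E x)%:E = \int[mu]_x ((\1_E x)%:E * (phi x)%:E))%E.
  move=> mE; rewrite integral_indic//= setIT /normal_prob integral_mkcond.
  apply: eq_integral => x _; rewrite patchE indicE.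
  by case: (x \in E); rewrite ?mul1e ?mul0e.
have sfE (h : {nnsfun _ >-> R}) :
    (\int[N01]_x (h x)%:E = \int[mu]_x ((h x)%:E * (phi x)%:E))%E.
  under [LHS]eq_integral do rewrite fimfunE -fsumEFin//.
  rewrite [LHS]ge0_integral_fsum//; last 2 first.
    - by move=> r; exact/measurable_EFinP/measurableT_comp.
    - by move=> n x _; rewrite EFinM nnfun_muleindic_ge0.
  under [RHS]eq_integral.
    move=> x _; rewrite fimfunE -fsumEFin// ge0_mule_fsuml; last first.
      by move=> r; rewrite EFinM nnfun_muleindic_ge0.
    over.
  rewrite [RHS]ge0_integral_fsum//; last 2 first.
    - move=> r; apply: emeasurable_funM => //.
      by apply/measurable_EFinP; apply/measurableT_comp.
    - by move=> n x _; rewrite EFinM mule_ge0// nnfun_muleindic_ge0.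
  apply: eq_fsbigr => r _; under [RHS]eq_integral do rewrite EFinM -muleA.
  rewrite integralZl_indic_nnsfun//= indE//.
  (* A negative [r] is not a value of the nonnegative function [h], so both sides vanish in that
     case. *)
  have [r0|r0] := leP 0 r.
    rewrite [RHS]ge0_integralZl//=.
    - by apply: emeasurable_funM => //; apply/measurable_EFinP; exact: measurable_indic.
    - by move=> x _; rewrite mule_ge0// lee_fin.
  rewrite preimage_nnfun0// indic0.
  under eq_integral do rewrite mul0e; rewrite integral0 mule0.
  by under eq_integral do rewrite mul0e mule0; rewrite integral0.
pose f_ := nnsfun_approx measurableT mf.
transitivity (lim (\int[N01]_x (f_ n x)%:E @[n --> \oo])%E).
  rewrite -monotone_convergence//=.
  - apply: eq_integral => ? /[!inE] xD; apply/esym/cvg_lim => //=.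
    exact: cvg_nnsfun_approx.
  - by move=> n; exact/measurable_EFinP/measurable_funTS.
  - by move=> n ? _; rewrite lee_fin.
  - by move=> ? _ ? ? mn; rewrite lee_fin; exact/lefP/nd_nnsfun_approx.
under eq_fun do rewrite sfE.
rewrite -monotone_convergence//=.
- apply: eq_integral => x _; apply/cvg_lim => //=.
  apply: cvgeMr => //; exact: cvg_nnsfun_approx.
- move=> n; apply: emeasurable_funM => //.
  exact/measurable_EFinP/measurable_funTS.
- by move=> n x _; rewrite mule_ge0// lee_fin.
- move=> x _ a b ab; rewrite lee_wpmul2r// lee_fin.
  exact/lefP/nd_nnsfun_approx.
Qed.

Lemma integrable_normal_prob (f : _ -> R) : measurable_fun setT f ->
  mu.-integrable setT (fun x => (f x * phi x)%:E) ->
  N01.-integrable setT (EFin \o f).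
Proof.
move=> mf /integrableP[_ ifoo]; apply/integrableP; split.
  exact/measurable_EFinP.
rewrite ge0_integral_normal_prob//; last first.
  by apply: measurableT_comp => //; apply/measurable_EFinP.
apply: le_lt_trans ifoo; apply: ge0_le_integral => //.
- by move=> x _; rewrite mule_ge0// lee_fin normal_pdf_ge0.
- apply: emeasurable_funM; first by apply: measurableT_comp => //; apply/measurable_EFinP.
  by apply/measurable_EFinP; exact: measurable_normal_pdf.
- apply: measurableT_comp => //; apply/measurable_EFinP.
  by apply: measurable_funM => //; exact: measurable_normal_pdf.
- by move=> x _; rewrite /= normrM (ger0_norm (normal_pdf_ge0 _ _ _)) EFinM.
Qed.

Lemma integral_normal_prob (f : _ -> R) :
  mu.-integrable setT (fun x => (f x * phi x)%:E) ->
  measurable_fun setT f ->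
  (\int[N01]_x (f x)%:E = \int[mu]_x (f x * phi x)%:E)%E.
Proof.
move=> ifphi mf; have ifN := integrable_normal_prob mf ifphi.
rewrite [LHS]integralE [RHS]integralE.
congr (_ - _)%E; rewrite ge0_integral_normal_prob//.
- apply: eq_integral => x _; rewrite !funeposE/= maxe_pMl// ?mul0e ?EFinM//.
  by rewrite lee_fin normal_pdf_ge0.
- by apply: measurable_funepos; apply/measurable_EFinP.
- apply: eq_integral => x _; rewrite !funenegE/= maxe_pMl ?lee_fin ?normal_pdf_ge0//.
  by rewrite mul0e -mulNr EFinM.
- by apply: measurable_funeneg; apply/measurable_EFinP.
Qed.

Lemma normal_pdf01E x : phi x = phi 0 * expR (- (x ^+ 2 / 2)).
Proof.
rewrite normal_pdfE ?oner_neq0//= /normal_fun !subr0 expr1n !expr0n/= oppr0 mul0r expR0.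
by rewrite mulr1 mulNr.
Qed.

Lemma normal_pdf01N x : phi (- x) = phi x.
Proof. by rewrite (normal_pdf01E (- x)) (normal_pdf01E x) sqrrN. Qed.

(** Since x^2 exp(- x^2 / 4) <= 4, the function is dominated by a multiple of exp(- x^2 / 4), which
    is up to a constant the normal density of variance 2. *)
Lemma integrable_sqr_normal_pdf : mu.-integrable setT (fun x => (x ^+ 2 * phi x)%:E).
Proof.
have s2 : Num.sqrt 2 != 0 :> R by rewrite gt_eqF// sqrtr_gt0.
pose K := 4 * phi 0 / normal_pdf 0 (Num.sqrt 2) (0:R).
have := integrableZl measurableT K (@integrable_normal_pdf R 0 (Num.sqrt 2)).
apply: le_integrable => //.
  apply/measurable_EFinP/measurable_funM => //.
  exact: measurable_normal_pdf.
move=> x _; rewrite /= lee_fin.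
rewrite ger0_norm; last exact: mulr_ge0 (sqr_ge0 _) (normal_pdf_ge0 _ _ _).
apply: le_trans (ler_norm _).
rewrite (normal_pdf01E x) /K [X in _ <= _ * X](_ : _ =
    normal_pdf 0 (Num.sqrt 2) (0:R) * expR (- (x ^+ 2 / 4))); last first.
  rewrite normal_pdfE// /normal_fun !subr0 expr0n/= oppr0 mul0r expR0 mulr1.
  by rewrite sqr_sqrtr// mulNr; congr (_ * expR (- (_ / _))); lra.
rewrite [leRHS]mulrA divfK; last first.
  rewrite normal_pdfE// /normal_fun !subr0 expr0n/= oppr0 mul0r expR0 mulr1.
  by rewrite gt_eqF// normal_peak_gt0.
rewrite mulrCA (mulrC 4) -[leRHS]mulrA ler_wpM2l ?normal_pdf_ge0//.
have -> : - (x ^+ 2 / 2) = - (x ^+ 2 / 4) - x ^+ 2 / 4 by lra.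
rewrite expRD mulrCA [leRHS]mulrC ler_wpM2l ?expR_ge0// expRN.
rewrite ler_pdivrMr ?expR_gt0//.
have := expR_ge1Dx (x ^+ 2 / 4); lra.
Qed.

Lemma is_derive_normal_pdf (x : R) : is_derive x 1 phi (- x * phi x).
Proof.
have dsq : is_derive x 1 (fun y : R => - (y ^+ 2 / 2)) (- x).
  by apply: is_derive_eq; rewrite /GRing.scale/=; field.
have dexp := @is_derive1_comp R expR _ x _ _ (is_derive_expR _) dsq.
have -> : phi = phi 0 \*: (expR \o fun y : R => - (y ^+ 2 / 2)).
  by apply/funext => y; exact: normal_pdf01E.
apply: is_derive_eq (is_deriveZ _ dexp) _; rewrite /= /GRing.scale/=;
ring.
Qed.

Lemma continuous_phi : continuous phi.
Proof. by apply: continuous_normal_pdf; rewrite oner_eq0. Qed.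

(** * Stein's identity in one variable *)

Section stein.
Variables (f g : R -> R) (K : R).
Hypothesis fg : forall x : R, is_derive x 1 f (g x).
Hypothesis cg : continuous g.
Hypothesis fK : forall x, `|f x| <= K.
Hypothesis gK : forall x, `|g x| <= K.

Let cf : continuous f.
Proof.
move=> x; apply: differentiable_continuous; apply/derivable1_diffP.
by have [] := fg x.
Qed.

(** The derivative of [f * phi], because phi' = - x phi. Stein's identity says that its integral is
    0. *)
Let h x := g x * phi x - x * f x * phi x.

Let ch : continuous h.
Proof.
move=> x; apply: cvgB; apply: cvgM; [exact: cg|exact: continuous_phi| |exact: continuous_phi].
by apply: cvgM => //; exact: cf.
Qed.

Let ifphi : mu.-integrable setT (fun x => (x * f x * phi x)%:E).
Proof.
have i1 := integrableD measurableT integrable_sqr_normal_pdf (@integrable_normal_pdf R 0 1).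
have := integrableZl measurableT K i1.
apply: le_integrable => //.
  apply/measurable_EFinP; apply: continuous_measurable_fun => x.
  by apply: cvgM; [apply: cvgM => //; exact: cf|exact: continuous_phi].
move=> x _; rewrite /= lee_fin; apply: le_trans (ler_norm _).
have p0 := normal_pdf_ge0 0 1 x.
have -> : K * (x ^+ 2 * phi x + phi x) = K * (x ^+ 2 + 1) * phi x by ring.
rewrite !normrM (ger0_norm p0) ler_wpM2r// mulrC ler_pM//.
have := sqr_ge0 (`|x| - 1 / 2); have := real_normK (num_real x); nra.
Qed.

Let igphi : mu.-integrable setT (fun x => (g x * phi x)%:E).
Proof.
have := integrableZl measurableT K (@integrable_normal_pdf R 0 1).
apply: le_integrable => //.
  apply/measurable_EFinP; apply: continuous_measurable_fun => x.
  by apply: cvgM; [exact: cg|exact: continuous_phi].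
move=> x _; rewrite /= lee_fin; apply: le_trans (ler_norm _).
have p0 := normal_pdf_ge0 0 1 x.
by rewrite normrM (ger0_norm p0) ler_wpM2r.
Qed.

Let ih : mu.-integrable setT (EFin \o h).
Proof.
rewrite (_ : EFin \o h = (fun x => (g x * phi x)%:E - (x * f x * phi x)%:E)%E).
  exact: integrableB.
by apply/funext => x; rewrite /= EFinB.
Qed.

Let dF (x : R) : is_derive x 1 (f * phi) (h x).
Proof.
have df := fg x; have dphi := is_derive_normal_pdf x.
apply: is_derive_eq; rewrite /h /GRing.scale/=; ring.
Qed.

Let int_itv (m : R) : 0 < m -> (\int[mu]_(x in `[(- m)%R, m]) (h x)%:E =
  (f m * phi m - f (- m) * phi (- m))%:E)%E.
Proof.
move=> m0.
have cF : continuous (f * phi).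
  by move=> x; apply: cvgM; [exact: cf|exact: continuous_phi].
rewrite (@continuous_FTC2 _ h (f * phi)) ?EFinB//.
- by rewrite gtrN.
- exact: continuous_subspaceT.
- split.
  + by move=> x _; have [] := dF x.
  + exact/cvg_at_right_filter/cF.
  + exact/cvg_at_left_filter/cF.
- by move=> x _; rewrite derive1E; have [_ ->] := dF x.
Qed.

(** Over [- m, m] the integral is the boundary term of [int_itv], which tends to 0 because f is
    bounded; dominated convergence identifies the limit with the integral over the line. *)
Let integral_h : (\int[mu]_x (h x)%:E = 0)%E.
Proof.
pose I (n : nat) : set R := `[- n.+1%:R, n.+1%:R]%classic.
have mI n : measurable (I n) by exact: measurable_itv.
have cvg1 : (\int[mu]_(x in I n) (h x)%:E)%E @[n --> \oo] --> (\int[mu]_x (h x)%:E)%E.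
  rewrite (_ : (fun n => _) = (fun n => \int[mu]_x ((fun x => (h x)%:E) \_ (I n)) x)%E); last first.
    by apply/funext => n; rewrite integral_mkcond.
  apply: (@dominated_cvg _ _ _ mu _ measurableT _ _ (abse \o (EFin \o h))) => //.
  - move=> n; apply/(measurable_restrict _ _ _).1 => //.
      exact: mI.
    by case/integrableP : ih => mh _; exact: measurable_funS mh.
  - move=> x _; apply: cvg_near_cst.
    near=> n; rewrite patchE ifT// inE /I/= in_itv/= -ler_norml.
    rewrite (le_trans (ltW (truncnS_gt `|x|)))// ler_nat.
    near: n; exact: nbhs_infty_ge.
  - exact: integrable_abse.
  - move=> n x _; rewrite patchE; case: ifPn => // _; by rewrite abse0 abse_ge0.
have cvg2 : (\int[mu]_(x in I n) (h x)%:E)%E @[n --> \oo] --> 0%E.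
  under eq_fun do rewrite int_itv ?ltr0n//.
  apply: cvg_EFin; first exact: nearW.
  (* With m = n + 1, the boundary term is at most 2 K phi(m), and exp(- m^2 / 2) <= 1 / m. *)
  apply: norm_cvg0; apply: (@squeeze_cvgr _ _ _ _ (cst 0) (fun n => (2 * K * phi 0) * harmonic n)).
  - apply: nearW => n; rewrite normr_ge0/= /harmonic/=.
    have n0 : 0 < n.+1%:R :> R by rewrite ltr0n.
    rewrite normal_pdf01N -mulrBl normrM (ger0_norm (normal_pdf_ge0 _ _ _)).
    rewrite -mulrA ler_pM// ?normal_pdf_ge0//.
      by rewrite (le_trans (ler_normB _ _))// mulr_natl mulr2n lerD.
    rewrite normal_pdf01E ler_wpM2l ?normal_pdf_ge0// expRN lef_pV2 ?posrE ?expR_gt0//.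
    have := expR_ge1Dx (n.+1%:R ^+ 2 / 2 : R); have := sqr_ge0 (n.+1%:R - 1 : R); nra.
  - exact: cvg_cst.
  - rewrite -[X in _ --> X](mulr0 (2 * K * phi 0)); apply: cvgMr; exact: cvg_harmonic.
exact: cvg_unique cvg1 cvg2.
Unshelve. all: end_near. Qed.

Lemma normal_stein :
  (\int[N01]_x (x * f x)%:E = \int[N01]_x (g x)%:E)%E.
Proof.
have mg : measurable_fun setT g by exact: continuous_measurable_fun.
have mf : measurable_fun setT f by exact: continuous_measurable_fun.
rewrite !integral_normal_prob//; last exact: measurable_funM.
(* In the extended reals a vanishing difference gives equality only for finite terms, which
   integrability provides. *)
have fin_sub_eq0 (a b : \bar R) :
    a \is a fin_num -> b \is a fin_num -> (b - a = 0)%E -> a = b.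
  by case: a b => [a||] [b||]//= _ _ [] /eqP; rewrite subr_eq0 => /eqP ->.
apply: fin_sub_eq0; [exact: integrable_fin_num|exact: integrable_fin_num|].
by rewrite -integralB// -[RHS]integral_h; apply: eq_integral => x _; rewrite -EFinB.
Qed.

End stein.

Lemma integrable_sqr_normal_prob :
  N01.-integrable setT (fun x => (x ^+ 2)%:E).
Proof.
apply: (@integrable_normal_prob (fun x => x ^+ 2)) => //.
exact: integrable_sqr_normal_pdf.
Qed.

End std_normal.

(** * The Gaussian measure on R^n and Stein's identity in one of its coordinates *)

Section gauss.
Context {R : realType}.
Notation N01 := (@normal_prob R 0 1).
Notation mR := (measurableTypeR R).

Lemma measurable_tnthR n (i : 'I_n) :
  measurable_fun setT (fun Y : n.-tuple mR => (tnth Y i : R)).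
Proof. exact: (@measurable_tnth _ mR n i). Qed.

Lemma ge0_integral_gaussS n (F : n.+1.-tuple mR -> \bar R) :
  measurable_fun setT F -> (forall Y, 0 <= F Y)%E ->
  (\int[gauss n.+1]_Y F Y = \int[gauss n]_Y \int[N01]_x F (cons_pair (x, Y)))%E.
Proof.
move=> mF F0; rewrite /= ge0_integral_distribution//.
rewrite (@fubini_tonelli2 _ _ _ _ _ (N01 : probability mR R) (gauss n))//.
  by apply: measurableT_comp => //; exact: measurable_funPT.
by move=> x; exact: F0.
Qed.

Lemma integrable_gaussS n (F : n.+1.-tuple mR -> \bar R) :
  (gauss n.+1).-integrable setT F ->
  ((N01 : probability mR R) \x gauss n)%E.-integrable setT (F \o @cons_pair R n).
Proof.
move=> /integrableP[mF iF]; apply/integrableP; split.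
  by apply: measurableT_comp => //; exact: measurable_funPT.
move: iF; rewrite /= ge0_integral_distribution//.
exact: measurableT_comp.
Qed.

Lemma integral_gaussS12 n (F : n.+1.-tuple mR -> \bar R) :
  (gauss n.+1).-integrable setT F ->
  (\int[gauss n.+1]_Y F Y = \int[N01]_x \int[gauss n]_Y F (cons_pair (x, Y)))%E.
Proof.
move=> iF; have iFc := integrable_gaussS iF.
rewrite /= integral_distribution//; last by case/integrableP : iF.
by rewrite -(integral12_prod_meas1 iFc).
Qed.

Lemma integral_gaussS21 n (F : n.+1.-tuple mR -> \bar R) :
  (gauss n.+1).-integrable setT F ->
  (\int[gauss n.+1]_Y F Y = \int[gauss n]_Y \int[N01]_x F (cons_pair (x, Y)))%E.
Proof.
move=> iF; have iFc := integrable_gaussS iF.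
rewrite /= integral_distribution//; last by case/integrableP : iF.
by rewrite -(integral21_prod_meas1 iFc).
Qed.

Lemma integrable_bounded d (T : measurableType d) (P : probability T R)
  (f : T -> R) K : measurable_fun setT f -> (forall x, `|f x| <= K) ->
  P.-integrable setT (EFin \o f).
Proof.
move=> mf fK; apply: (@le_integrable _ _ _ P _ _ _ (cst K%:E)) => //.
- exact/measurable_EFinP.
- by move=> x _; rewrite /= lee_fin (le_trans (fK x))// ler_norm.
- exact: finite_measure_integrable_cst.
Qed.

Lemma integrable_sqr_tnth n (i : 'I_n) :
  (gauss n).-integrable setT (fun Y => ((tnth Y i : R) ^+ 2)%:E).
Proof.
have mF m (j : 'I_m) : measurable_fun setT (fun Y : m.-tuple mR => ((tnth Y j : R) ^+ 2)%:E).
  by apply/measurable_EFinP/measurable_funX; exact: measurable_tnthR.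
elim: n => [|n IH] in i *; first by case: i.
apply/integrableP; split; first exact: mF.
rewrite ge0_integral_gaussS//; last by apply: measurableT_comp => //; exact: mF.
case: (unliftP ord0 i) => [j ->|->].
  have /integrableP[_] := IH j; apply: le_lt_trans.
  rewrite le_eqVlt; apply/orP; left; apply/eqP; apply: eq_integral => Y _.
  rewrite (eq_integral (cst `|((tnth Y j : R) ^+ 2)%:E|%E)); last first.
    by move=> x _; rewrite /= tnthS.
  rewrite integral_cst//.
  by rewrite [X in (_ * X)%E](_ : _ = 1%E) ?mule1//; exact: probability_setT.
have /integrableP[_ i2] := @integrable_sqr_normal_prob R.
rewrite (eq_integral (cst (\int[N01]_x `|((x : R) ^+ 2)%:E|)%E)); last first.
  by move=> Y _; apply: eq_integral => x _; rewrite /= tnth0.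
rewrite integral_cst//.
by rewrite [X in (_ * X < _)%E](_ : _ = 1%E) ?mule1//; exact: probability_setT.
Qed.

Lemma integrable_normr_tnth n (i : 'I_n) :
  (gauss n).-integrable setT (fun Y => (`|tnth Y i : R|)%:E).
Proof.
have i1 : (gauss n).-integrable setT (EFin \o (cst 1 : _ -> R)).
  exact: finite_measure_integrable_cst.
have := integrableD measurableT i1 (integrable_sqr_tnth i).
apply: le_integrable => //.
  apply/measurable_EFinP; apply: measurableT_comp => //; exact: measurable_tnthR.
move=> Y _; rewrite /= lee_fin normr_id (le_trans _ (ler_norm _))//.
have := sqr_ge0 (`|tnth Y i : R| - 1 / 2); have := real_normK (num_real (tnth Y i)).
rewrite /cst; nra.
Qed.

Lemma integrable_tnth_mul n (i : 'I_n) (f : n.-tuple mR -> R) K :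
  measurable_fun setT f -> (forall Y, `|f Y| <= K) ->
  (gauss n).-integrable setT (fun Y => ((tnth Y i : R) * f Y)%:E).
Proof.
move=> mf fK; have := integrableZl measurableT K (integrable_normr_tnth i).
apply: le_integrable => //.
  by apply/measurable_EFinP/measurable_funM => //; exact: measurable_tnthR.
move=> Y _; rewrite /= lee_fin (le_trans _ (ler_norm _))// normrM mulrC.
by rewrite ler_wpM2r.
Qed.

(** The counterpart of [cons_pair] for row vectors, which lets a function on R^(n+1) be sliced along
    its first coordinate. *)
Definition cons_row n (a : R) (z : 'rV[R]_n) : 'rV[R]_n.+1 :=
  \row_i oapp (z 0) a (unlift ord0 i).

Lemma row_of_cons n (a : R) (Y : n.-tuple mR) :
  row_of_tuple (cons_pair (a, Y)) = cons_row a (row_of_tuple Y).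
Proof.
apply/rowP => i; rewrite !mxE; case: (unliftP ord0 i) => [j ->|->] /=.
  by rewrite tnthS mxE.
by rewrite tnth0.
Qed.

Lemma cons_rowD n (a t : R) (z : 'rV[R]_n) :
  cons_row (a + t) z = cons_row a z + t *: delta_mx 0 ord0.
Proof.
apply/rowP => i; rewrite !mxE eqxx /=; case: (unliftP ord0 i) => [j ->|->] /=.
  by rewrite mulr0 addr0.
by rewrite mulr1.
Qed.

Lemma cons_rowDr n (a t : R) (z : 'rV[R]_n) j :
  cons_row a (z + t *: delta_mx 0 j) =
  cons_row a z + t *: delta_mx 0 (lift ord0 j).
Proof.
apply/rowP => i; rewrite !mxE eqxx /=; case: (unliftP ord0 i) => [l ->|->] /=.
  by rewrite !mxE (inj_eq lift_inj).
by rewrite mulr0 addr0.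
Qed.

Lemma measurable_cons_pair1 n (a : R) :
  measurable_fun setT (fun Y : n.-tuple mR => cons_pair (a : mR, Y)).
Proof.
apply: (@measurableT_comp _ _ _ _ _ _ (@cons_pair R n)); first exact: measurable_funPT.
exact: measurable_pair1.
Qed.

(** Induction on n by Fubini. If q is not the first coordinate, that one is frozen and the induction
    hypothesis applies to the slice; if it is, the tail is frozen and the one-variable identity
    applies. Derivatives are asked for along direction q alone, a condition that slices inherit. *)
Lemma gauss_stein n (q : 'I_n) (f g : 'rV[R]_n -> R) K :
  measurable_fun setT (fun Y : n.-tuple mR => f (row_of_tuple Y)) ->
  measurable_fun setT (fun Y : n.-tuple mR => g (row_of_tuple Y)) ->
  (forall z, `|f z| <= K) -> (forall z, `|g z| <= K) ->
  (forall z (t : R), is_derive t 1 (fun r : R => f (z + r *: delta_mx 0 q))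
                 (g (z + t *: delta_mx 0 q))) ->
  (forall z, continuous (fun r : R => g (z + r *: delta_mx 0 q))) ->
  (\int[gauss n]_Y ((tnth Y q : R) * f (row_of_tuple Y))%:E =
   \int[gauss n]_Y (g (row_of_tuple Y))%:E)%E.
Proof.
elim: n => [|n IH] in q f g *; first by case: q.
move=> mf mg fK gK fg cg.
have if_ := integrable_tnth_mul q mf (fun Y => fK (row_of_tuple Y)).
have ig_ := integrable_bounded (gauss n.+1) mg (fun Y => gK (row_of_tuple Y)).
case: (unliftP ord0 q) => [j qj|q0].
  rewrite (integral_gaussS12 if_) (integral_gaussS12 ig_).
  apply: eq_integral => x _; rewrite qj.
  under eq_integral do rewrite /= tnthS/= row_of_cons.
  under [RHS]eq_integral do rewrite /= row_of_cons.
  apply: (IH j (fun z => f (cons_row x z)) (fun z => g (cons_row x z))).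
  - have := measurableT_comp mf (@measurable_cons_pair1 n x).
    by apply: eq_measurable_fun => Y _; rewrite /= row_of_cons.
  - have := measurableT_comp mg (@measurable_cons_pair1 n x).
    by apply: eq_measurable_fun => Y _; rewrite /= row_of_cons.
  - by move=> z; exact: fK.
  - by move=> z; exact: gK.
  - by move=> z t; under eq_fun do rewrite cons_rowDr; rewrite cons_rowDr -qj; exact: fg.
  - by move=> z; under eq_fun do rewrite cons_rowDr -qj; exact: cg.
rewrite (integral_gaussS21 if_) (integral_gaussS21 ig_).
apply: eq_integral => Y _; rewrite q0.
under eq_integral do rewrite /= tnth0 row_of_cons -[X in cons_row X _]add0r cons_rowD -q0.
under [RHS]eq_integral do rewrite /= row_of_cons -[X in cons_row X _]add0r cons_rowD -q0.
exact: (normal_stein (fg _) (cg _) (fun x => fK _) (fun x => gK _)).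
Qed.

End gauss.

(** * Differential calculus along curves *)

Section one_variable.
Context {R : realType}.
Implicit Types f df : R -> R.

Lemma is_derive1P f (s l : R) :
  is_derive s 1 f l <-> h^-1 * (f (h + s) - f s) @[h --> 0^'] --> l.
Proof.
have E : (fun h : R => h^-1 * (f (h + s) - f s)) =
         (fun h => h^-1 *: ((f \o shift s) (h *: (1 : R)) - f s)).
  by apply/funext => h; rewrite /= [h *: _]mulr1.
rewrite E; split=> [[dfs <-]|fl]; first exact: dfs.
by apply: DeriveDef; [exact: cvgP fl|exact: cvg_lim fl].
Qed.

(** The sign of [a] is left free, since it will be a coordinate of an arbitrary increment. *)
Lemma MVT0 f df (a : R) : (forall x : R, `|x| <= `|a| -> is_derive x 1 f (df x)) ->
  exists2 c, `|c| <= `|a| & f a - f 0 = df c * a.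
Proof.
move=> fd.
have cf x : `|x| <= `|a| -> {for x, continuous f}.
  move=> xa; apply: differentiable_continuous; apply/derivable1_diffP.
  by have [] := fd x xa.
have [a0|a0|a0] := ltgtP 0 a; last first.
- by exists a => //; rewrite -a0 subrr mulr0.
- have xa x : x \in `[a, 0] -> `|x| <= `|a|.
    by rewrite in_itv/= => /andP[h1 h2]; rewrite !ler0_norm ?lerN2// ltW.
  have [|//|c cI e] := @MVT R f df a 0 a0.
  + by move=> x /subset_itv_oo_cc /xa; exact: fd.
  + by apply: derivable_within_continuous => x /xa /fd [].
  + exists c; first by apply: xa; exact: subset_itv_oo_cc.
    by rewrite -opprB e sub0r mulrN opprK.
- have xa x : x \in `[0, a] -> `|x| <= `|a|.
    by rewrite in_itv/= => /andP[h1 h2]; rewrite !ger0_norm// ltW.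
  have [|//|c cI e] := @MVT R f df 0 a a0.
  + by move=> x /subset_itv_oo_cc /xa; exact: fd.
  + by apply: derivable_within_continuous => x /xa /fd [].
  + exists c; first by apply: xa; exact: subset_itv_oo_cc.
    by rewrite e subr0.
Qed.

(** If l were negative, df would be negative just to the right of df 0 = 0, and the mean value
    theorem would give a value of f below f 0. *)
Lemma global_min_derive f df (l : R) :
  (forall s : R, is_derive s 1 f (df s)) -> is_derive (0 : R) 1 df l ->
  (forall s, f 0 <= f s) -> df 0 = 0 /\ 0 <= l.
Proof.
move=> fd dfl f0.
have df0 : df 0 = 0.
  have D : is_derive (0 : R) 1 f 0.
    apply: (@derive1_at_min R f (-1) 1 0) => [|t _||t _]; last exact: f0.
    - by lra.
    - by have [] := fd t.
    - by rewrite in_itv/= ltrN10 ltr01.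
  by have [_ <-] := fd 0; have [_ ->] := D.
split => //; rewrite leNgt; apply/negP => l0.
have /is_derive1P dfl0 := dfl; rewrite df0 in dfl0.
have [e /= e0 he] : \forall h \near 0^', h^-1 * (df (h + 0) - 0) < 0 :=
  cvgr_lt _ dfl0 _ l0.
have e20 : 0 < e / 2 by rewrite divr_gt0.
have [c] := @MVT R f df 0 (e / 2) e20 (fun x _ => fd x)
  (derivable_within_continuous (fun x _ => @ex_derive _ _ _ _ _ _ _ (fd x))).
rewrite in_itv/= subr0 => /andP[c0 ce] E.
have := he c; rewrite /ball/= sub0r normrN gtr0_norm// addr0 subr0.
move=> /(_ _ (lt0r_neq0 c0)); rewrite pmulr_rlt0 ?invr_gt0// => dfc.
have := f0 (e / 2); rewrite -subr_ge0 E pmulr_lge0// leNgt dfc//.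
by rewrite (lt_trans ce)// ltr_pdivrMr// ltr_pMr// ltr1n.
Qed.

(** Only earlier times are compared, because the minimum may sit at the final time; this yields a
    sign rather than a vanishing derivative. *)
Lemma left_min_derive f (s l : R) : 0 < s -> is_derive s 1 f l ->
  (forall r, 0 <= r <= s -> f s <= f r) -> l <= 0.
Proof.
move=> s0 /is_derive1P fl smin; rewrite leNgt; apply/negP => l0.
have [e /= e0 he] : \forall h \near 0^', h^-1 * (f (h + s) - f s) > 0 :=
  cvgr_gt _ fl _ l0.
(* Small enough for the difference quotient to be positive, and at most [s] so that s - h is still
   an admissible time. *)
pose h := Num.min (e / 2) s.
have h0 : 0 < h by rewrite lt_min s0 divr_gt0.
have := he (- h); rewrite /ball/= sub0r opprK gtr0_norm//.
have he2 : h < e.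
  by rewrite gt_min; apply/orP; left; rewrite ltr_pdivrMr// ltr_pMr// ltr1n.
move=> /(_ he2); rewrite oppr_eq0 => /(_ (lt0r_neq0 h0)).
rewrite invrN mulNr -mulrN pmulr_rgt0 ?invr_gt0// oppr_gt0 subr_lt0 addrC ltNge.
by rewrite smin// subr_ge0 ge_min lexx orbT/= gerBl ltW.
Qed.

End one_variable.

(** * First-order expansion from continuous partial derivatives *)

Section chain_rule.
Context {R : realType}.

Lemma is_derive_line (V : normedModType R) (f : V -> R) (q v : V) (r : R) :
  derivable f (q + r *: v) v ->
  is_derive r 1 (fun t : R => f (q + t *: v)) ('D_v f (q + r *: v)).
Proof.
move=> fd; apply/is_derive1P.
rewrite (_ : (fun h : R => _) =
    (fun h => h^-1 *: ((f \o shift (q + r *: v)) (h *: v) - f (q + r *: v)))).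
  exact: fd.
by apply/funext => h /=; rewrite scalerDl addrCA.
Qed.

Variables (n : nat) (f : 'rV[R]_n -> R) (p : 'rV[R]_n).
Hypothesis fd : \forall v \near p, forall i, derivable f v (delta_mx 0 i).
Hypothesis fc : forall i, {for p, continuous (partial i f)}.

(** Truncation to the first k coordinates: the points p + head k v form a path from p to p + v that
    changes one coordinate at a time. *)
Let head k (v : 'rV[R]_n) : 'rV[R]_n :=
  \row_j if (j < k)%N then v 0 j else 0.

Let head0 v : head 0 v = 0.
Proof. by apply/rowP => j; rewrite !mxE. Qed.

Let headn v : head n v = v.
Proof. by apply/rowP => j; rewrite !mxE ltn_ord. Qed.

Let headS (k : 'I_n) v : head k.+1 v = head k v + v 0 k *: delta_mx 0 k.
Proof.
apply/rowP => j; rewrite !mxE eqxx /= ltnS leq_eqVlt.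
have [->|jk] := eqVneq j k; first by rewrite eqxx ltnn mulr1 add0r.
by rewrite (negbTE (_ : val j != val k)) ?mulr0 ?addr0.
Qed.

Let norm_head_line (k : 'I_n) (c : R) (v : 'rV[R]_n) :
  `|c| <= `|v 0 k| -> `|head k v + c *: delta_mx 0 k| <= `|v|.
Proof.
move=> cv; apply: rV_norm_le => // j; rewrite !mxE eqxx /=.
have [->|jk] := eqVneq j k.
  by rewrite ltnn add0r mulr1 (le_trans cv)// rV_norm_coord.
rewrite mulr0 addr0; case: ifPn => _; rewrite ?normr0// rV_norm_coord//.
Qed.

(** The increment telescopes along the truncations of v; each step is handled by the mean value
    theorem in one coordinate, at a point close to p where the partial derivative is close to its
    value at p. *)
Lemma C1_linear_approx (e : R) : 0 < e -> \forall v \near (0 : 'rV[R]_n),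
  `|f (p + v) - f p - \sum_j v 0 j * partial j f p| <= e * `|v|.
Proof.
(* Each of the n steps costs e' |v|; dividing by n + 1 also covers n = 0. *)
move=> e0; pose e' := e / n.+1%:R.
have e'0 : 0 < e' by rewrite divr_gt0.
have near_p (i : 'I_n) : \forall v \near p, derivable f v (delta_mx 0 i) /\
    `|partial i f p - partial i f v| <= e'.
  apply: filterI; first by apply: filterS fd => v; exact.
  have ci : partial i f x @[x --> p] --> partial i f p := @fc i.
  by move/cvgrPdist_le : ci; exact.
have := @filter_forall _ _ _ (nbhs p) (nbhs_filter p) near_p.
move=> /(@nbhs_ballP _ _ p)[d /= d0 dP].
apply/nbhs_ballP; exists d => //= v; rewrite -ball_normE/= sub0r normrN => vd.
have pd w : `|w| <= `|v| -> forall i, derivable f (p + w) (delta_mx 0 i) /\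
    `|partial i f p - partial i f (p + w)| <= e'.
  move=> wv; apply: dP; rewrite -ball_normE/= opprD addNKr normrN.
  exact: le_lt_trans vd.
have step (k : 'I_n) : `|f (p + head k.+1 v) - f (p + head k v) - v 0 k * partial k f p|
    <= e' * `|v|.
  rewrite headS addrA.
  have [|c cv] := @MVT0 _ (fun r => f (p + head k v + r *: delta_mx 0 k))
      (fun r => partial k f (p + head k v + r *: delta_mx 0 k)) (v 0 k).
    move=> r rv; apply: is_derive_line; rewrite -addrA.
    by apply: (pd _ _ k).1; exact: norm_head_line.
  rewrite scale0r addr0 => ->; rewrite [_ * v 0 k]mulrC -mulrBr normrM mulrC.
  rewrite ler_pM ?rV_norm_coord// distrC -addrA.
  by apply: (pd _ _ k).2; exact: norm_head_line.
have -> : f (p + v) - f p = \sum_(k < n) (f (p + head k.+1 v) - f (p + head k v)).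
  rewrite -(big_mkord xpredT (fun k => f (p + head k.+1 v) - f (p + head k v))).
  by rewrite telescope_sumr// headn head0 addr0.
rewrite -sumrB (le_trans (ler_norm_sum _ _ _))//.
rewrite (le_trans (ler_sum _ (fun k _ => step k)))// sumr_const card_ord.
rewrite -mulrnAl ler_wpM2r// /e' -[leLHS]mulr_natr -mulrA ger_pMr// mulrC.
by rewrite ler_pdivrMr// mul1r ler_nat.
Qed.

End chain_rule.

(** * The chain rule along a curve *)

Section chain_rule_curve.
Context {R : realType}.

Lemma is_derive_curve n (f : 'rV[R]_n -> R) (c : R -> 'rV[R]_n) (s : R)
    (dc : 'rV[R]_n) :
  (\forall v \near c s, forall i, derivable f v (delta_mx 0 i)) ->
  (forall i, {for c s, continuous (partial i f)}) ->
  (forall j, is_derive s 1 (fun r => c r 0 j) (dc 0 j)) ->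
  is_derive s 1 (fun r => f (c r)) (\sum_j dc 0 j * partial j f (c s)).
Proof.
move=> fd fc cd; apply/is_derive1P.
pose v (h : R) := c (h + s) - c s.
have wd : (fun h : R => h^-1 *: v h) @ 0^' --> dc.
  apply: cvg_row => j; have /is_derive1P := cd j.
  by under [X in _ -> X @ _ --> _]eq_fun do rewrite /v !mxE.
(* The increment of the curve is h times its difference quotient, hence tends to 0. *)
have v0 : v @ 0^' --> (0 : 'rV[R]_n).
  have h0 : (fun h : R => h *: (h^-1 *: v h)) @ 0^' --> (0 : R) *: dc.
    by apply: cvgZ => //; apply: cvg_within_filter; exact: cvg_id.
  rewrite scale0r in h0; apply: cvg_trans h0; apply: near_eq_cvg.
  near=> h; rewrite scalerA divff ?scale1r//.
  by near: h; exact: nbhs_dnbhs_neq.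
have Ld : (fun h : R => \sum_j (h^-1 *: v h) 0 j * partial j f (c s)) @ 0^' -->
    \sum_j dc 0 j * partial j f (c s).
  apply: cvg_big => [|j _]; first exact: add_continuous.
  by apply: cvgMl; exact: (cvg_comp _ _ wd (@coord_continuous _ _ _ 0 j dc)).
apply/cvgrPdist_le => e e0.
(* The difference quotient of the curve is eventually bounded by |dc| + 1, so an error e1 |v h|
   divided by |h| stays below e / 2. *)
pose e1 := e / 2 / (`|dc| + 1).
have dc1 : 0 < `|dc| + 1 by rewrite ltr_wpDl.
have e10 : 0 < e1 by rewrite !divr_gt0.
near=> h.
have hn0 : h != 0 by near: h; exact: nbhs_dnbhs_neq.
rewrite (le_trans (ler_distD (\sum_j (h^-1 *: v h) 0 j * partial j f (c s)) _ _))//.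
rewrite (splitr e) lerD//.
  near: h; move/cvgrPdist_le : Ld; apply; by rewrite divr_gt0.
have -> : \sum_j (h^-1 *: v h) 0 j * partial j f (c s) =
    h^-1 * \sum_j v h 0 j * partial j f (c s).
  by rewrite mulr_sumr; apply: eq_bigr => j _; rewrite !mxE mulrA.
rewrite -mulrBr normrM distrC.
have -> : f (c (h + s)) = f (c s + v h) by rewrite /v subrKC.
have h1 : `|f (c s + v h) - f (c s) - \sum_j v h 0 j * partial j f (c s)| <= e1 * `|v h|.
  near: h; exact: v0 (C1_linear_approx fd fc e10).
have h2 : `|h^-1 *: v h| <= `|dc| + 1.
  near: h; apply: (cvgr_norm_le _ wd); by rewrite ltrDl.
rewrite (le_trans (ler_wpM2l (normr_ge0 _) h1))// mulrCA -normrZ.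
by rewrite (le_trans (ler_wpM2l (ltW e10) h2))// /e1 divfK// gt_eqF.
Unshelve. all: end_near. Qed.

End chain_rule_curve.

(** * The heat flow of a test function *)

Section test_functions.
Context {R : realType}.

Definition test_fun n (f : 'rV[R]_n -> R) :=
  smooth_on setT f /\ compactly_supported f.

Variable n : nat.
Implicit Types f : 'rV[R]_n -> R.

Lemma smooth_onP f : smooth_on setT f -> forall s,
  continuous (partials s f) /\
  forall x i, derivable (partials s f) x (delta_mx 0 i).
Proof.
move=> [U [_ UT fU]] s; split=> x; last by move=> i; have [_] := fU s x (UT x I).
by have [] := fU s x (UT x I).
Qed.

(** Off its closed support f vanishes near each point, and so does its derivative. This stability
    lets the flow of f be differentiated repeatedly. *)
Lemma test_fun_partial f i : test_fun f -> test_fun (partial i f).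
Proof.
move=> [sf cf]; split.
  have [U [oU UT fU]] := sf; exists U; split => // s x Ux.
  have -> : partials s (partial i f) = partials (rcons s i) f.
    by rewrite /partials foldr_rcons.
  exact: fU.
apply: subclosed_compact cf _; first exact: closed_closure.
rewrite [X in _ `<=` X]((closure_id _).1 (@closed_closure _ [set x | f x != 0])).
apply: closure_subset => x /=; apply: contraPP => xf; apply/negP; rewrite negbK.
have : open (~` closure [set x | f x != 0]) by rewrite -closedC setCK; exact: closed_closure.
rewrite openE => /(_ _ xf) xint.
rewrite /partial (@near_eq_derive _ _ _ _ (cst 0)) ?derive_cst//.
apply: filterS xint => y /= yf; apply/eqP; apply: contrapT => /negP fy.
by apply: yf; exact: subset_closure.
Qed.

Lemma test_fun_continuous f : test_fun f -> continuous f.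
Proof. by move=> [sf _]; have [] := smooth_onP sf [::]. Qed.

Lemma test_fun_bounded_support f : test_fun f ->
  exists2 r : R, 0 < r & forall z, f z != 0 -> `|z| <= r.
Proof.
move=> [_ /compact_bounded[M [Mreal MP]]].
exists (`|M| + 1); first by rewrite ltr_wpDl.
move=> z fz; apply: (MP _ _ z); last exact: subset_closure.
by rewrite ltr_pwDr// ler_norm.
Qed.

Lemma test_fun_bounded f : test_fun f ->
  exists2 K : R, 0 <= K & forall z, `|f z| <= K.
Proof.
move=> tf; have [_ cf] := tf.
have /compact_bounded[M [Mreal MP]] : compact (f @` closure [set x | f x != 0]).
  apply: continuous_compact cf; apply: continuous_subspaceT.
  exact: test_fun_continuous.
exists (`|M| + 1); first by rewrite addr_ge0.
move=> z; have [->|fz] := eqVneq (f z) 0; first by rewrite normr0 addr_ge0.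
apply: MP; first by rewrite ltr_pwDr// ler_norm.
by exists z => //; exact: subset_closure.
Qed.

Lemma test_fun_decay f : test_fun f ->
  exists2 K : R, 0 <= K & forall z, `|f z| * (1 + `|z| ^+ 2) <= K.
Proof.
move=> tf; have [K K0 fK] := test_fun_bounded tf.
have [r r0 fr] := test_fun_bounded_support tf.
have r1 : 0 <= 1 + r ^+ 2 by rewrite addr_ge0// sqr_ge0.
exists (K * (1 + r ^+ 2)); first by rewrite mulr_ge0.
move=> z; have [->|fz] := eqVneq (f z) 0; first by rewrite normr0 mul0r mulr_ge0.
by rewrite ler_pM// ?addr_ge0 ?sqr_ge0// lerD2l ler_pXn2r ?nnegrE ?(ltW r0)// fr.
Qed.

Lemma test_fun_curve f (c : R -> 'rV[R]_n) (s : R) (dc : 'rV[R]_n) :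
  test_fun f -> (forall j, is_derive s 1 (fun r => c r 0 j) (dc 0 j)) ->
  is_derive s 1 (fun r => f (c r)) (\sum_j dc 0 j * partial j f (c s)).
Proof.
move=> [sf _] cd; apply: is_derive_curve => //.
  by apply: filterE => v i; have [_] := smooth_onP sf [::]; exact.
by move=> i; have [+ _] := smooth_onP sf [:: i]; exact.
Qed.

Lemma is_derive_coord_line (q w : 'rV[R]_n) (s : R) j :
  is_derive s 1 (fun t : R => (q + t *: w) 0 j) (w 0 j).
Proof.
rewrite (_ : (fun t : R => _) = (cst (q 0 j) + w 0 j \*: @id R)%R); last first.
  by apply/funext => t; rewrite !mxE /= mulrC.
by apply: is_derive_eq; rewrite add0r /GRing.scale/= mulr1.
Qed.

Lemma test_fun_line f (q w : 'rV[R]_n) (s : R) : test_fun f ->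
  is_derive s 1 (fun t : R => f (q + t *: w))
    (\sum_j w 0 j * partial j f (q + s *: w)).
Proof.
by move=> tf; apply: (test_fun_curve tf) => j; exact: is_derive_coord_line.
Qed.

Lemma test_fun_lipschitz f : test_fun f ->
  exists2 K : R, 0 <= K & forall y z, `|f y - f z| <= K * `|y - z|.
Proof.
move=> tf; have /= H j := test_fun_bounded (test_fun_partial j tf).
pose K j := projT1 (cid2 (H j)).
have K0 j : 0 <= K j by rewrite /K; case: cid2.
have fK j z : `|partial j f z| <= K j by rewrite /K; case: cid2.
exists (\sum_j K j); first by apply: sumr_ge0 => j _.
move=> y z; have [c _] := @MVT0 _ (fun t : R => f (z + t *: (y - z))) _ 1
  (fun s _ => test_fun_line z (y - z) s tf).
rewrite scale1r scale0r addr0 subrKC mulr1 => ->.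
rewrite (le_trans (ler_norm_sum _ _ _))// mulr_suml ler_sum// => j _.
by rewrite normrM mulrC ler_pM// rV_norm_coord.
Qed.

End test_functions.

(** * Gaussian averages: differentiation, heat equation and decay *)

Section gauss_flow.
Context {R : realType}.
Notation mR := (measurableTypeR R).

Lemma integrable_norm_row n :
  (gauss n).-integrable setT (fun Y : n.-tuple mR => (`|row_of_tuple Y|)%:E).
Proof.
have := integrable_sum measurableT (index_enum 'I_n) (P := xpredT)
  (fun i _ => @integrable_normr_tnth R n i).
apply: le_integrable => //.
  apply/measurable_EFinP; apply: continuous_measurable_row; exact: norm_continuous.
move=> Y _; rewrite /= sumEFin lee_fin normr_id (le_trans _ (ler_norm _))//.
apply: rV_norm_le => [|j]; first by apply: sumr_ge0.
by rewrite mxE (bigD1 j)//= lerDl sumr_ge0.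
Qed.

Lemma integrable_sqr_norm_row n :
  (gauss n).-integrable setT (fun Y : n.-tuple mR => (`|row_of_tuple Y| ^+ 2)%:E).
Proof.
have := integrable_sum measurableT (index_enum 'I_n) (P := xpredT)
  (fun i _ => @integrable_sqr_tnth R n i).
apply: le_integrable => //.
  apply/measurable_EFinP/measurable_funX; apply: continuous_measurable_row.
  exact: norm_continuous.
move=> Y _; rewrite /= sumEFin lee_fin; apply: le_trans (ler_norm _).
rewrite ger0_norm ?sqr_ge0//.
have s0 : 0 <= \sum_(i < n) (tnth Y i : R) ^+ 2 by apply: sumr_ge0 => i _; exact: sqr_ge0.
rewrite -(sqr_sqrtr s0) ler_pXn2r ?nnegrE ?sqrtr_ge0//.
apply: rV_norm_le => [|j]; first exact: sqrtr_ge0.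
rewrite mxE -sqrtr_sqr ler_wsqrtr// (bigD1 j)//= lerDl sumr_ge0// => i _.
exact: sqr_ge0.
Qed.

Lemma Rintegral_sum d (T : measurableType d) (mu : {measure set T -> \bar R})
    (n : nat) (h : 'I_n -> T -> R) :
  (forall i, mu.-integrable setT (EFin \o h i)) ->
  \int[mu]_x (\sum_i h i x) = \sum_i \int[mu]_x h i x.
Proof.
move=> ih; rewrite /Rintegral; under eq_integral do rewrite -sumEFin.
rewrite integral_sum//= sum_fine// => i _.
exact: (integrable_fin_num measurableT (ih i)).
Qed.

(** Differentiation under the integral sign: the t-derivative of the integrand is bounded, uniformly
    in t, by a multiple of the integrable function |w|. A constant w gives derivatives in space, and
    w = Y S the derivative in s. *)
Lemma is_derive_gauss d (f : 'rV[R]_d -> R) (q w : 'rV[R]_d -> 'rV[R]_d) (t0 : R) :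
  test_fun f -> continuous q -> continuous w ->
  (gauss d).-integrable setT (fun Y : d.-tuple mR => (`|w (row_of_tuple Y)|)%:E) ->
  is_derive t0 1
    (fun t : R => \int[gauss d]_Y f (q (row_of_tuple Y) + t *: w (row_of_tuple Y)))
    (\sum_j \int[gauss d]_Y
      (w (row_of_tuple Y) 0 j *
       partial j f (q (row_of_tuple Y) + t0 *: w (row_of_tuple Y)))).
Proof.
move=> tf cq cw iw.
have /= H j := test_fun_bounded (test_fun_partial j tf).
pose K j := projT1 (cid2 (H j)).
have K0 j : 0 <= K j by rewrite /K; case: cid2.
have fK j z : `|partial j f z| <= K j by rewrite /K; case: cid2.
have [Kf Kf0 fKf] := test_fun_bounded tf.
have cqw t : continuous (fun z => q z + t *: w z).
  by move=> z; apply: (cvgD (cq z)); apply: cvgZr; exact: cw.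
pose F (t : R) (Y : d.-tuple mR) := f (q (row_of_tuple Y) + t *: w (row_of_tuple Y)).
have dF (t : R) (Y : d.-tuple mR) : is_derive t 1 (fun r => F r Y)
    (\sum_j w (row_of_tuple Y) 0 j * partial j f (q (row_of_tuple Y) + t *: w (row_of_tuple Y))).
  exact: test_fun_line.
have iF t : (gauss d).-integrable setT (EFin \o F t).
  apply: (@integrable_bounded _ _ _ _ _ Kf) => [|Y]; last exact: fKf.
  apply: (@continuous_measurable_row _ _ (fun z => f (q z + t *: w z))) => z.
  by apply: cvg_comp; [exact: cqw|exact: test_fun_continuous].
pose G (Y : d.-tuple mR) := (\sum_j K j) * `|w (row_of_tuple Y)|.
have d1F t Y : partial1of2 F t Y = \sum_j w (row_of_tuple Y) 0 j *
    partial j f (q (row_of_tuple Y) + t *: w (row_of_tuple Y)).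
  by rewrite partial1of2E; have [_ ->] := dF t Y.
have bnd j t Y : `|w (row_of_tuple Y) 0 j *
    partial j f (q (row_of_tuple Y) + t *: w (row_of_tuple Y))| <= K j * `|w (row_of_tuple Y)|.
  by rewrite normrM mulrC ler_pM// rV_norm_coord.
have Ia : `]t0 - 1, t0 + 1[%classic t0 by rewrite /= in_itv/= ltrBlDr ltrDl ltr01.
have G0 Y : 0 <= G Y by rewrite mulr_ge0// sumr_ge0.
have iG : (gauss d).-integrable setT (EFin \o G).
  exact: (integrableZl measurableT (\sum_j K j) iw).
have Gub t Y : `|partial1of2 F t Y| <= G Y.
  by rewrite d1F (le_trans (ler_norm_sum _ _ _))// /G mulr_suml ler_sum.
apply/is_derive1P.
have := @cvg_differentiation_under_integral R _ _ (gauss d) F setT measurableT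
  t0 (t0 - 1) (t0 + 1) Ia (fun t _ => iF t)
  (fun t Y _ _ => @ex_derive _ _ _ _ _ _ _ (dF t Y)) G G0 iG (fun t Y _ _ => Gub t Y).
rewrite -Rintegral_sum.
  by rewrite (funext (d1F t0)).
move=> j; have := integrableZl measurableT (K j) iw.
apply: le_integrable => //.
  apply/measurable_EFinP.
  apply: (@continuous_measurable_row _ _ (fun z => w z 0 j * partial j f (q z + t0 *: w z))) => z.
  have c1 : {for z, continuous (fun z0 => w z0 0 j)}.
    exact: continuous_comp (cw z) (@coord_continuous R 1 d 0 j (w z)).
  have c2 : {for z, continuous (fun z0 => partial j f (q z0 + t0 *: w z0))}.
    have cp := test_fun_continuous (test_fun_partial j tf).
    exact: continuous_comp (cqw t0 z) (cp _).
  exact: continuousM c1 c2.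
by move=> Y _; rewrite /= lee_fin; apply: le_trans (ler_norm _); exact: bnd.
Qed.

Lemma continuous_sumr (T : topologicalType) n (h : 'I_n -> T -> R) :
  (forall i, continuous (h i)) -> continuous (fun x => \sum_i h i x).
Proof.
move=> hc x; apply: cvg_big => [|i _]; [exact: add_continuous|exact: hc].
Qed.

Section flow.
Variables (d : nat) (S : 'M[R]_d).

(** The heat flow in the variable s = sqrt(2 t), where S is to be the square root of A_j^T C A_j.
    The argument of f is affine in s, so the flow is differentiable in s even at s = 0. *)
Definition gflow (f : 'rV[R]_d -> R) (y : 'rV[R]_d) (s : R) : R :=
  \int[gauss d]_Y f (y + s *: (row_of_tuple Y *m S)).

Implicit Types f : 'rV[R]_d -> R.

Let continuous_shift y s : continuous (fun z : 'rV[R]_d => y + s *: (z *m S)).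
Proof.
have cy : continuous (fun _ : 'rV[R]_d => y) by exact: cst_continuous.
by move=> z; apply: (cvgD (cy z)); apply: cvgZr; exact: continuous_mulmxr.
Qed.

Lemma integrable_gflow f y s : test_fun f ->
  (gauss d).-integrable setT
    (fun Y : d.-tuple mR => (f (y + s *: (row_of_tuple Y *m S)))%:E).
Proof.
move=> tf; have [K K0 fK] := test_fun_bounded tf.
apply: (@integrable_bounded _ _ _ _ _ K) => [|Y]; last exact: fK.
apply: (@continuous_measurable_row _ _ (fun z => f (y + s *: (z *m S)))) => z.
by apply: cvg_comp; [exact: continuous_shift|exact: test_fun_continuous].
Qed.

Lemma gauss_Rintegral_cst (a : R) : \int[gauss d]_Y a = a.
Proof.
rewrite Rintegral_cst// [X in fine X](_ : _ = 1%E) ?mulr1//.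
exact: probability_setT.
Qed.

Lemma gflow_ge f y s a : test_fun f -> (forall z, a <= f z) -> a <= gflow f y s.
Proof.
move=> tf af; rewrite -[leLHS]gauss_Rintegral_cst; apply: le_Rintegral => //.
- exact: finite_measure_integrable_cst.
- exact: integrable_gflow.
Qed.

Lemma gflow_le f y s a : test_fun f -> (forall z, f z <= a) -> gflow f y s <= a.
Proof.
move=> tf af; rewrite -[leRHS]gauss_Rintegral_cst; apply: le_Rintegral => //.
- exact: integrable_gflow.
- exact: finite_measure_integrable_cst.
Qed.

(** The Lipschitz bound of f is averaged, using that |Y| has a finite mean; it provides joint
    continuity in space and time. *)
Lemma gflow_lipschitz f : test_fun f -> exists2 K : R, 0 <= K &
  forall y y' s s', `|gflow f y s - gflow f y' s'| <= K * (`|y - y'| + `|s - s'|).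
Proof.
move=> tf; have [K K0 fK] := test_fun_lipschitz tf.
have [KS KS0 SK] := mulmx_norm_le S.
pose E1 := \int[@gauss R d]_Y `|row_of_tuple Y|.
have E10 : 0 <= E1 by apply: Rintegral_ge0.
exists (K * (1 + KS * E1)); first by rewrite mulr_ge0// addr_ge0// mulr_ge0.
move=> y y' s s'; rewrite /gflow -RintegralB//; [|exact: integrable_gflow..].
rewrite (le_trans (le_normr_Rintegral _ _))//.
  have := integrableB measurableT (integrable_gflow y s tf) (integrable_gflow y' s' tf).
  by apply: eq_integrable => // Y _; rewrite /= EFinB.
pose b (Y : d.-tuple mR) := K * `|y - y'| + (K * `|s - s'| * KS) * `|row_of_tuple Y|.
have ib2 : (@gauss R d).-integrable setT
    (fun Y : d.-tuple mR => ((K * `|s - s'| * KS) * `|row_of_tuple Y|)%:E).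
  exact: (integrableZl measurableT _ (integrable_norm_row d)).
have ib : (@gauss R d).-integrable setT (EFin \o b).
  have ic : (@gauss R d).-integrable setT (EFin \o (fun=> K * `|y - y'|)).
    exact: finite_measure_integrable_cst.
  by have := integrableD measurableT ic ib2; apply: eq_integrable => // Y _.
apply: (@le_trans _ _ (\int[@gauss R d]_Y b Y)).
  apply: le_Rintegral => //.
    have := integrableB measurableT (integrable_gflow y s tf) (integrable_gflow y' s' tf).
    by move=> /integrable_norm; apply: eq_integrable.
  move=> Y _; rewrite (le_trans (fK _ _))// /b -!mulrA -mulrDr ler_wpM2l//.
  rewrite opprD addrACA -scalerBl (le_trans (ler_normD _ _))// lerD2l.
  by rewrite normrZ ler_wpM2l.
rewrite /b RintegralD//; last exact: finite_measure_integrable_cst.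
rewrite gauss_Rintegral_cst RintegralZl//; last exact: integrable_norm_row.
rewrite -/E1; have n1 := normr_ge0 (y - y'); have n2 := normr_ge0 (s - s').
have k1 : 0 <= K * (KS * E1) * `|y - y'| by rewrite !mulr_ge0.
have k2 : 0 <= K * `|s - s'| by rewrite mulr_ge0.
have -> : K * (1 + KS * E1) * (`|y - y'| + `|s - s'|) =
  K * `|y - y'| + K * `|s - s'| * KS * E1 + (K * (KS * E1) * `|y - y'| + K * `|s - s'|) by ring.
by rewrite lerDl addr_ge0.
Qed.

Lemma gflow_line f (y a : 'rV[R]_d) (s t : R) : test_fun f ->
  is_derive t 1 (fun r : R => gflow f (y + r *: a) s)
    (\sum_j a 0 j * gflow (partial j f) (y + t *: a) s).
Proof.
move=> tf; have ca : continuous (fun _ : 'rV[R]_d => a) by exact: cst_continuous.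
have ia : (@gauss R d).-integrable setT (fun=> (`|a|)%:E).
  exact: finite_measure_integrable_cst.
have := is_derive_gauss t tf (@continuous_shift y s) ca ia.
under eq_fun do under eq_Rintegral do rewrite addrAC.
under eq_bigr => j _.
  under eq_Rintegral do rewrite addrAC.
  rewrite RintegralZl//; last exact: integrable_gflow (test_fun_partial j tf).
  over.
by [].
Qed.

(** Stein's identity in the coordinate q: the derivative of f(y + s Y S) in Y_q is s times the
    derivative of f along row q of S. *)
Lemma gauss_mul_tnth f (y : 'rV[R]_d) (s : R) (q : 'I_d) : test_fun f ->
  \int[gauss d]_Y ((tnth Y q : R) * f (y + s *: (row_of_tuple Y *m S))) =
  s * \sum_r S q r * gflow (partial r f) y s.
Proof.
move=> tf.
pose g (z : 'rV[R]_d) : R := \sum_r s * S q r * partial r f (y + s *: (z *m S)).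
have /= H j := test_fun_bounded (test_fun_partial j tf).
pose K j := projT1 (cid2 (H j)).
have K0 j : 0 <= K j by rewrite /K; case: cid2.
have fK j z : `|partial j f z| <= K j by rewrite /K; case: cid2.
have [Kf Kf0 fKf] := test_fun_bounded tf.
pose Kg := \sum_r `|s * S q r| * K r.
have Kg0 : 0 <= Kg by apply: sumr_ge0 => r _; rewrite mulr_ge0.
have gK z : `|g z| <= Kg.
  rewrite (le_trans (ler_norm_sum _ _ _))// ler_sum// => r _.
  by rewrite normrM ler_wpM2l.
have cg : continuous g.
  apply: continuous_sumr => r z.
  have cp := test_fun_continuous (test_fun_partial r tf).
  have c2 : {for z, continuous (fun z0 : 'rV[R]_d => partial r f (y + s *: (z0 *m S)))}.
    exact: continuous_comp (@continuous_shift y s z) (cp _).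
  have c1 : {for z, continuous (fun _ : 'rV[R]_d => s * S q r)} by exact: cst_continuous.
  exact: continuousM c1 c2.
have cf : continuous (fun z : 'rV[R]_d => f (y + s *: (z *m S))).
  move=> z; have cp := test_fun_continuous tf.
  exact: continuous_comp (@continuous_shift y s z) (cp _).
have line z (r : R) : y + s *: ((z + r *: delta_mx 0 q) *m S) =
    y + s *: (z *m S) + r *: (s *: row q S).
  by rewrite mulmxDl -scalemxAl -rowE scalerDr addrA !scalerA mulrC.
have stein : (\int[gauss d]_Y ((tnth Y q : R) * f (y + s *: (row_of_tuple Y *m S)))%:E =
    \int[gauss d]_Y (g (row_of_tuple Y))%:E)%E.
  apply: (@gauss_stein R d q (fun z : 'rV[R]_d => f (y + s *: (z *m S))) g (Kf + Kg)
    (continuous_measurable_row cf) (continuous_measurable_row cg)).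
  - by move=> z; rewrite (le_trans (fKf _))// lerDl.
  - by move=> z; rewrite (le_trans (gK _))// lerDr.
  - move=> z t; under eq_fun do rewrite line.
    have := test_fun_line (y + s *: (z *m S)) (s *: row q S) t tf.
    by move=> /is_derive_eq; apply; rewrite /g line; apply: eq_bigr => r _; rewrite !mxE.
  - move=> z r; have cl : {for r, continuous (fun r0 : R => z + r0 *: delta_mx 0 q)}.
      by apply: (cvgD (cvg_cst z)); apply: cvgZl; exact: cvg_id.
    exact: continuous_comp cl (cg _).
transitivity (\int[@gauss R d]_Y g (row_of_tuple Y)); first by rewrite /Rintegral stein.
rewrite Rintegral_sum; last first.
  move=> r; have := integrableZl measurableT (s * S q r)
    (integrable_gflow y s (test_fun_partial r tf)).
  by apply: eq_integrable => // Y _; rewrite /= EFinM.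
rewrite mulr_sumr; apply: eq_bigr => r _.
by rewrite RintegralZl ?mulrA//; exact: integrable_gflow (test_fun_partial r tf).
Qed.

(** Differentiating in s brings down the factors (Y S)_p, and integration by parts trades each Y_q
    for s times a further derivative. The factor s is dt/ds for t = s^2 / 2. *)
Lemma gflow_time f (y : 'rV[R]_d) (s : R) : test_fun f ->
  is_derive s 1 (fun t : R => gflow f y t)
    (s * \sum_p \sum_r (S^T *m S) p r * gflow (partial r (partial p f)) y s).
Proof.
move=> tf; have cy : continuous (fun _ : 'rV[R]_d => y) by exact: cst_continuous.
have [KS KS0 SK] := mulmx_norm_le S.
have iS : (@gauss R d).-integrable setT (fun Y : d.-tuple mR => (`|row_of_tuple Y *m S|)%:E).
  have := integrableZl measurableT KS (integrable_norm_row d).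
  apply: le_integrable => //.
    apply/measurable_EFinP; apply: (@continuous_measurable_row _ _ (fun z => `|z *m S|)) => z.
    exact: (cvg_norm (@continuous_mulmxr _ _ _ S z)).
  by move=> Y _; rewrite /= lee_fin normr_id (le_trans (SK _))// ler_norm.
have := is_derive_gauss s tf cy (@continuous_mulmxr _ _ _ S) iS.
move=> /is_derive_eq; apply; rewrite mulr_sumr; apply: eq_bigr => p _.
have tp := test_fun_partial p tf.
transitivity (\int[@gauss R d]_Y \sum_q S q p *
    ((tnth Y q : R) * partial p f (y + s *: (row_of_tuple Y *m S)))).
  apply: eq_Rintegral => Y _; rewrite mxE mulr_suml; apply: eq_bigr => q _.
  by rewrite mxE mulrAC mulrC.
have [Kp Kp0 fKp] := test_fun_bounded tp.
have iq q : (@gauss R d).-integrable setT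
    (fun Y => ((tnth Y q : R) * partial p f (y + s *: (row_of_tuple Y *m S)))%:E).
  apply: (@integrable_tnth_mul _ _ _ _ Kp) => //.
  by have /integrableP[/measurable_EFinP] := integrable_gflow y s tp.
rewrite Rintegral_sum; last first.
  by move=> q; have := integrableZl measurableT (S q p) (iq q); apply: eq_integrable.
rewrite (eq_bigr (fun q => s * \sum_r S q p * (S q r * gflow (partial r (partial p f)) y s))).
  rewrite -mulr_sumr exchange_big/=; congr (_ * _); apply: eq_bigr => r _.
  by rewrite mxE mulr_suml; apply: eq_bigr => q _; rewrite mxE mulrA.
move=> q _; rewrite (RintegralZl _ _ (iq q))//.
by rewrite (gauss_mul_tnth y s q tp) [LHS]mulrCA; congr (_ * _); rewrite mulr_sumr.
Qed.

(** With z = y + s Y S, the inequality 1 + |y|^2 <= 2 (1 + |z|^2) (1 + |z - y|^2) moves the weight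
    onto f(z), where it is bounded, at the cost of the second moment of Y. The bound is uniform for
    |s| <= s1. *)
Lemma gflow_decay f (s1 : R) : test_fun f -> exists2 K : R, 0 <= K &
  forall y s, `|s| <= s1 -> `|gflow f y s| * (1 + `|y| ^+ 2) <= K.
Proof.
move=> tf; have [K K0 fK] := test_fun_decay tf.
have [KS KS0 SK] := mulmx_norm_le S.
pose E2 := \int[@gauss R d]_Y (`|row_of_tuple Y| ^+ 2).
have E20 : 0 <= E2 by apply: Rintegral_ge0 => Y _; exact: sqr_ge0.
pose c := 2 * K * (s1 * KS) ^+ 2.
have c0 : 0 <= c by rewrite mulr_ge0 ?sqr_ge0// mulr_ge0.
exists (2 * K + c * E2); first by rewrite addr_ge0// mulr_ge0.
move=> y s ss1; have y1 : 0 <= 1 + `|y| ^+ 2 by rewrite addr_ge0 ?sqr_ge0.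
have iF := integrable_gflow y s tf.
rewrite (le_trans (ler_wpM2r y1 (le_normr_Rintegral _ iF)))//.
have iN := integrable_norm iF.
rewrite mulrC -RintegralZl//.
have iE : (@gauss R d).-integrable setT (EFin \o (fun=> 2 * K)).
  exact: finite_measure_integrable_cst.
have iE2 : (@gauss R d).-integrable setT (fun Y : d.-tuple mR => (c * `|row_of_tuple Y| ^+ 2)%:E).
  exact: (integrableZl measurableT _ (integrable_sqr_norm_row d)).
have -> : 2 * K + c * E2 = \int[@gauss R d]_Y (2 * K + c * `|row_of_tuple Y| ^+ 2).
  rewrite RintegralD// gauss_Rintegral_cst RintegralZl//.
  exact: integrable_sqr_norm_row.
apply: le_Rintegral => //.
- exact: (integrableZl measurableT _ iN).
- by have := integrableD measurableT iE iE2; apply: eq_integrable.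
move=> Y _; set w := row_of_tuple Y *m S; set z := y + s *: w.
have yz : `|y| <= `|z| + `|s *: w|.
  by rewrite -[y in leLHS](addrK (s *: w)); exact: ler_normB.
have sw : `|s *: w| <= s1 * KS * `|row_of_tuple Y|.
  by rewrite normrZ -mulrA ler_pM//; exact: SK.
have := fK z; have := normr_ge0 (f z).
have := normr_ge0 z; have := normr_ge0 y; have := normr_ge0 (s *: w).
have := normr_ge0 (row_of_tuple Y).
move: yz sw; rewrite /c.
move: (`|y|) (`|z|) (`|s *: w|) (`|row_of_tuple Y|) (`|f z|) => a b e g h.
move=> ab eg g0 e0 a0 b0 h0 hK.
have h1 : 1 + a ^+ 2 <= 2 * (1 + b ^+ 2) * (1 + e ^+ 2).
  have : a ^+ 2 <= (b + e) ^+ 2 by rewrite ler_pXn2r// ?nnegrE// addr_ge0.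
  have := sqr_ge0 (b - e); have := sqr_ge0 (b * e); have := sqr_ge0 b; have := sqr_ge0 e.
  nra.
have h2 : e ^+ 2 <= (s1 * KS * g) ^+ 2.
  by rewrite ler_pXn2r// ?nnegrE// (le_trans e0).
rewrite mulrC (le_trans (ler_wpM2l h0 h1))//.
have -> : h * (2 * (1 + b ^+ 2) * (1 + e ^+ 2)) = h * (1 + b ^+ 2) * (2 * (1 + e ^+ 2)) by ring.
have e1 : 0 <= 2 * (1 + e ^+ 2) by rewrite mulr_ge0// addr_ge0 ?sqr_ge0.
rewrite (le_trans (ler_wpM2r e1 hK))//.
have := ler_wpM2l K0 h2; rewrite exprMn; nra.
Qed.

End flow.
End gauss_flow.

(** * Ranges of test functions and of their flow *)

Section range_test_fun.
Context {R : realType}.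

Lemma compact_norm_ball n (r : R) : compact [set z : 'rV[R]_n | `|z| <= r].
Proof.
apply: bounded_closed_compact.
  by exists r; split; [exact: num_real|move=> M rM z /= zr; rewrite (le_trans zr)// ltW].
have -> : [set z : 'rV[R]_n | `|z| <= r] = (fun z : 'rV[R]_n => `|z|) @^-1` [set x | x <= r] by [].
apply: closed_comp => [z _|]; [exact: norm_continuous|exact: closed_le].
Qed.

(** The extrema over a large ball are global, and the intermediate value theorem on the segment
    joining two extremal points fills the interval between them. *)
Lemma test_fun_range n (f : 'rV[R]_n -> R) : (0 < n)%N -> test_fun f ->
  exists m M : R, [/\ m <= 0 <= M, forall z, m <= f z <= M &
    forall a, m <= a <= M -> range f a].
Proof.
move=> n0 tf; have [r r0 fr] := test_fun_bounded_support tf.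
(* A point of the ball of radius r + 1 outside the support, so that 0 is a value of f; it exists
   because n > 0. *)
pose z0 : 'rV[R]_n := const_mx (r + 1).
have r1 : 0 <= r + 1 by rewrite addr_ge0// ltW.
have z0n : `|z0| <= r + 1 by apply: rV_norm_le => // j; rewrite mxE ger0_norm.
have z0r : r < `|z0|.
  rewrite (lt_le_trans _ (rV_norm_coord z0 (Ordinal n0)))// mxE ger0_norm//.
  by rewrite ltrDl.
have out z : r < `|z| -> f z = 0.
  by move=> rz; apply/eqP; apply: contraTT rz => /fr; rewrite -leNgt.
have fz0 := out z0 z0r.
pose A := [set z : 'rV[R]_n | `|z| <= r + 1].
have A0 : A !=set0 by exists z0.
have cA : compact A by exact: compact_norm_ball.
have cf : {within A, continuous f}.
  by apply: continuous_subspaceT; exact: test_fun_continuous.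
have [a aA fa] := EVT_max_rV A0 cA cf.
have [b bA fb] := EVT_min_rV A0 cA cf.
have za z : f z <= f a.
  have [zr|rz] := leP `|z| (r + 1); first by apply: fa; rewrite inE.
  rewrite (out z); last by rewrite (lt_trans _ rz)// ltrDl.
  by rewrite -fz0; apply: fa; rewrite inE.
have bz z : f b <= f z.
  have [zr|rz] := leP `|z| (r + 1); first by apply: fb; rewrite inE.
  rewrite (out z); last by rewrite (lt_trans _ rz)// ltrDl.
  by rewrite -fz0; apply: fb; rewrite inE.
exists (f b), (f a); split.
- by rewrite -{1 2}fz0 bz za.
- by move=> z; rewrite bz za.
move=> y /andP[by_ ya].
pose g (t : R) := f (b + t *: (a - b)).
have cg : {within `[0, 1], continuous g}.
  apply: derivable_within_continuous => t _.
  by have [] := test_fun_line b (a - b) t tf.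
have g0 : g 0 = f b by rewrite /g scale0r addr0.
have g1 : g 1 = f a by rewrite /g scale1r subrKC.
have [|c _ gc] := @IVT R g 0 1 y ler01 cg.
  by rewrite g0 g1 min_l ?max_r ?by_ ?ya//; exact: le_trans ya.
by exists (b + c *: (a - b)).
Qed.

Lemma gflow_range n (S : 'M[R]_n) (f : 'rV[R]_n -> R) y s :
  (0 < n)%N -> test_fun f -> range f (gflow S f y s).
Proof.
move=> n0 tf; have [m [M [_ fmM rf]]] := test_fun_range n0 tf.
apply: rf; rewrite gflow_ge ?gflow_le// => z; by have /andP[] := fmM z.
Qed.

(* The flow decays faster than 1 / (1 + |y|), and the range of f is an
   interval containing 0 to which the flow belongs. *)
Lemma gflow_damped n (S : 'M[R]_n) (f : 'rV[R]_n -> R) (s1 c : R) :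
  (0 < n)%N -> test_fun f -> 0 <= c -> exists2 r : R, 0 <= r &
  forall y s a, `|s| <= s1 -> r < `|y| -> 0 <= a <= c * (1 + `|y|) ->
    range f (gflow S f y s * a).
Proof.
move=> n0 tf c0; have [m [M [/andP[m0 M0] fmM rf]]] := test_fun_range n0 tf.
have [K K0 decay] := gflow_decay S s1 tf.
(* An endpoint equal to 0 sets no smallness condition, since the flow then has the right sign; the
   value 1 is arbitrary there. *)
pose eta (b : R) := if b == 0 then 1 else `|b|.
have eta0 b : 0 < eta b.
  by rewrite /eta; case: eqVneq => // b0; rewrite normr_gt0.
pose e := Num.min (eta m) (eta M).
have e0 : 0 < e by rewrite lt_min !eta0.
(* For |y| > 1 one has 1 + |y| <= 2 |y|, so the product is at most 2 c K / |y|, which is below e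
   beyond this threshold. *)
exists (1 + 2 * c * K / e).
  by rewrite addr_ge0// divr_ge0 ?(ltW e0)// !mulr_ge0.
move=> y s a ss1 yr /andP[a0 ac].
have ge0 : 0 <= 2 * c * K / e by rewrite divr_ge0 ?(ltW e0)// !mulr_ge0.
have y1 : 1 < `|y| by rewrite (le_lt_trans _ yr)// lerDl.
have small : `|gflow S f y s * a| <= e.
  rewrite normrM (ger0_norm a0); have := decay y s ss1.
  have := normr_ge0 (gflow S f y s); move: (`|gflow _ _ _ _|) => g g0 gK.
  have y2 : 2 * c * K <= e * `|y|.
    by rewrite -ler_pdivrMl// mulrC (le_trans _ (ltW yr))// lerDr.
  have h1 : g * a <= g * (2 * c * `|y|).
    rewrite ler_wpM2l// (le_trans ac)//; nra.
  rewrite (le_trans h1)//.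
  have h2 : g * `|y| ^+ 2 <= K by rewrite (le_trans _ gK)// ler_wpM2l// lerDr.
  have y0 : 0 < `|y| by rewrite (lt_trans _ y1).
  rewrite -(ler_pM2r y0) (le_trans _ y2)//.
  have -> : g * (2 * c * `|y|) * `|y| = 2 * c * (g * `|y| ^+ 2) by ring.
  by rewrite ler_wpM2l// mulr_ge0.
have gm : m <= gflow S f y s by apply: gflow_ge => // z; have /andP[] := fmM z.
have gM : gflow S f y s <= M by apply: gflow_le => // z; have /andP[] := fmM z.
apply: rf; move: small; rewrite ler_norml => /andP[h1 h2]; apply/andP; split.
  have [mE|mN] := eqVneq m 0; first by rewrite mE mulr_ge0// -mE.
  rewrite (le_trans _ h1)// lerNr ge_min /eta (negbTE mN) ler0_norm// lexx//.
have [ME|MN] := eqVneq M 0; first by rewrite ME mulr_le0_ge0// -ME.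
by rewrite (le_trans h2)// ge_min /eta (negbTE MN) (ger0_norm M0) lexx orbT.
Qed.

End range_test_fun.

(** * The minimum principle *)

Section min_principle.
Context {R : realType} {n k : nat} {d : 'I_n -> nat}.
Variables (A : forall j, 'M[R]_(k, d j)) (C : 'M[R]_k).
Variables (I : 'I_n -> interval R) (B : 'rV[R]_n -> R).
Variable u : forall j, 'rV[R]_(d j) -> R.
Arguments u : clear implicits.
Hypothesis d_gt0 : forall j, (0 < d j)%N.
Hypothesis smoothB : smooth_on (box I) B.
Hypothesis psdC : psdmx C.
Hypothesis pdA : forall j, pdmx ((A j)^T *m C *m A j).
Hypothesis tu : forall j, test_fun (u j).
Hypothesis u_box : forall x : 'rV[R]_k, box I (\row_j u j (x *m A j)).

Let S j := sqrtmx ((A j)^T *m C *m A j).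
Let phi (x : 'rV[R]_k) (s : R) : 'rV[R]_n :=
  \row_j gflow (S j) (u j) (x *m A j) s.

Lemma heat_flowE t x : 0 <= t -> heat_flow A C u t x = phi x (Num.sqrt (2 * t)).
Proof.
move=> t0; apply/rowP => j; rewrite !mxE /gflow.
have -> : sqrtmx (2 * t *: ((A j)^T *m C *m A j)) = Num.sqrt (2 * t) *: S j.
  by rewrite -sqrtmxZ ?sqrtr_ge0// sqr_sqrtr// mulr_ge0.
by apply: eq_Rintegral => Y _; rewrite -scalemxAr.
Qed.

(** The matrix A_j^T C A_j is invertible, so x A_j takes every value and the whole range of u_j lies
    in I_j. As the box is a product, a different x may serve for each j. *)
Lemma range_box (w : 'rV[R]_n) : (forall j, range (u j) (w 0 j)) -> box I w.
Proof.
move=> wr j; have [z _ uz] := wr j.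
have [x xA] : exists x : 'rV[R]_k, x *m A j = z.
  have Munit : (A j)^T *m C *m A j \in unitmx.
    rewrite -row_free_unit -kermx_eq0; apply/rowV0P => v /sub_kermxP vM.
    apply/eqP/negPn/negP => v0; have [_ /(_ v v0)] := pdA j.
    by rewrite vM mul0mx mxE ltxx.
  exists (z *m invmx ((A j)^T *m C *m A j) *m ((A j)^T *m C)).
  by rewrite -mulmxA mulmxKV.
by have := u_box x j; rewrite mxE xA uz.
Qed.

Lemma phi_range x s j : range (u j) (phi x s 0 j).
Proof. by rewrite mxE; exact: gflow_range. Qed.

Lemma phi_box x s : box I (phi x s).
Proof. by apply: range_box => j; exact: phi_range. Qed.

(** The point may lie on the boundary of the box, since B is smooth on an open neighborhood of
    it. *)
Lemma is_derive_partialsB (l : seq 'I_n) (c : R -> 'rV[R]_n) (s : R) (dc : 'rV[R]_n) :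
  box I (c s) -> (forall j, is_derive s 1 (fun r => c r 0 j) (dc 0 j)) ->
  is_derive s 1 (fun r => partials l B (c r))
    (\sum_j dc 0 j * partial j (partials l B) (c s)).
Proof.
have [U [oU IU BU]] := smoothB.
move=> /IU Uc cd; apply: is_derive_curve => //.
  by apply: filterS (open_nbhs_nbhs (conj oU Uc)) => v Uv i; have [_] := BU l v Uv.
by move=> i; have [] := BU (i :: l) _ Uc.
Qed.

Lemma continuous_phi_pair : continuous (fun xs : 'rV[R]_k * R => B (phi xs.1 xs.2)).
Proof.
have [U [oU IU BU]] := smoothB.
move=> [x s].
have cB : {for phi x s, continuous B} by have [] := BU [::] _ (IU _ (phi_box x s)).
suff cphi : {for (x, s), continuous (fun xs : 'rV[R]_k * R => phi xs.1 xs.2)}.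
  exact: continuous_comp cphi cB.
apply: cvg_row => j; rewrite mxE; under eq_fun do rewrite mxE.
have [K K0 lip] := gflow_lipschitz (S j) (tu j).
have [KA KA0 AK] := mulmx_norm_le (A j).
apply/cvgrPdist_le => e e0.
pose dl := e / ((K + 1) * (KA + 1)).
have K1 : 0 < (K + 1) * (KA + 1) by rewrite mulr_gt0// ltr_wpDl.
have dl0 : 0 < dl by rewrite divr_gt0.
have nx : \forall y \near x, `|x - y| <= dl.
  by apply/(@nbhs_ballP _ _ x); exists dl => //= y; rewrite -ball_normE => /ltW.
have ns : \forall t \near s, `|s - t| <= dl.
  by apply/nbhs_ballP; exists dl => //= t; rewrite /ball/= => /ltW.
exists ([set y | `|x - y| <= dl], [set t | `|s - t| <= dl]) => //=.
move=> [y t] [/= xy st]; rewrite (le_trans (lip _ _ _ _))//= -mulmxBl.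
rewrite (le_trans (ler_wpM2l K0 (lerD (AK _) (le_refl _))))//.
rewrite (le_trans (ler_wpM2l K0 (lerD (ler_wpM2l KA0 xy) st)))//.
rewrite -[X in _ + X]mul1r -mulrDl mulrA /dl mulrCA ger_pMr// ler_pdivrMr// mul1r.
by rewrite ler_wpM2r ?lerDl// addr_ge0.
Qed.

(** With N the sum of the A_j A_j^T over J and P a generalized inverse of N, take z = x N P. It
    depends on x through the x A_j alone, which bounds it; and (x - z) N = 0 makes the sum of the
    squared lengths of the (x - z) A_j vanish. *)
Lemma bounded_lift (J : {set 'I_n}) : exists2 K : R, 0 <= K &
  forall (x : 'rV[R]_k) (r : R), 0 <= r -> (forall j, j \in J -> `|x *m A j| <= r) ->
  exists2 z : 'rV[R]_k, `|z| <= K * r & forall j, j \in J -> (x - z) *m A j = 0.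
Proof.
pose N := \sum_(j in J) A j *m (A j)^T.
pose P := pinvmx N.
have KP j := mulmx_norm_le ((A j)^T *m P).
pose K j := projT1 (cid2 (KP j)).
have K0 j : 0 <= K j by rewrite /K; case: cid2.
have PK j (x : 'rV[R]_(d j)) : `|x *m ((A j)^T *m P)| <= K j * `|x|.
  by rewrite /K; case: cid2 => K' _ /= /(_ x).
exists (\sum_(j in J) K j); first by apply: sumr_ge0.
move=> x r r0 xr; exists (x *m N *m P).
  rewrite /N mulmx_sumr mulmx_suml (le_trans (ler_norm_sum _ _ _))//.
  rewrite mulr_suml ler_sum// => j jJ; rewrite (mulmxA x) -mulmxA (le_trans (PK _ _))//.
  by rewrite ler_wpM2l// xr.
set z := x *m N *m P.
have zN : (x - z) *m N = 0 by rewrite mulmxBl /z mulmxKpV ?submxMl// subrr.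
have : (x - z) *m N *m (x - z)^T = 0 by rewrite zN mul0mx.
rewrite /N mulmx_sumr mulmx_suml => /matrixP/(_ 0 0); rewrite summxE mxE => /eqP.
have sq j : (x - z) *m (A j *m (A j)^T) *m (x - z)^T =
    ((x - z) *m A j) *m ((x - z) *m A j)^T by rewrite trmx_mul !mulmxA.
rewrite psumr_eq0; last by move=> j _; rewrite sq row_mul_tr_ge0.
move=> /allP zJ j jJ; apply: mulmx_trr_eq0; apply/matrixP => a b.
rewrite !ord1 -sq [RHS]mxE; apply/eqP.
by have := zJ j (mem_index_enum _); rewrite jJ.
Qed.

Lemma liminf_bound (e : R) :
  (0 <= limf_einf (damped_inf A B u) (@at_infty R k))%E -> 0 < e ->
  exists R0 : R, forall x : 'rV[R]_k, R0 < enorm x ->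
  forall w : 'rV[R]_n, (forall j, range (u j) (w 0 j)) ->
  - e < B (\row_j (w 0 j / (1 + enorm (x *m A j)))).
Proof.
rewrite limf_einfE => liminf e0.
have : ((- e)%:E < ereal_sup [set ereal_inf (damped_inf A B u @` V) | V in @at_infty R k])%E.
  by rewrite (lt_le_trans _ liminf)// lte_fin oppr_lt0.
move=> /ereal_sup_gt[_ [V [R0 _ R0V] <-] eV].
exists R0 => x xR w wr.
rewrite -lte_fin (lt_le_trans eV)// (@le_trans _ _ (damped_inf A B u x))//.
  by apply: ereal_inf_lbound; exists x => //; exact: R0V.
by apply: ereal_inf_lbound; exists w.
Qed.

(* Downward induction on J: outside J either every |x A_j| exceeds the threshold of
   gflow_damped, or some j can be added to J at the cost of enlarging r. *)
Lemma phi_at_infinity (e s1 : R) :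
  (0 <= limf_einf (damped_inf A B u) (@at_infty R k))%E -> 0 < e ->
  forall (J : {set 'I_n}) (r : R), 0 <= r -> exists R1 : R, forall x : 'rV[R]_k,
    (forall j, j \in J -> `|x *m A j| <= r) -> R1 < `|x| ->
    forall s, `|s| <= s1 -> - e < B (phi x s).
Proof.
move=> liminf e0 J; have [R0 R0P] := liminf_bound liminf e0.
have [m Jm] := ubnP #|~: J|; elim: m => // m IH in J Jm * => r r0.
have [K K0 lift] := bounded_lift J.
pose KA j := projT1 (cid2 (mulmx_norm_le (A j))).
have KA0 j : 0 <= KA j by rewrite /KA; case: cid2.
have AK j (x : 'rV[R]_k) : `|x *m A j| <= KA j * `|x|.
  by rewrite /KA; case: cid2 => K' _ /= /(_ x).
(* Chosen to make [enz] hold below: moving x by z changes x A_j by at most KA_j K r, and the factor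
   d_j compares the Euclidean norm with the max norm. *)
pose c j := 1 + (d j)%:R + (d j)%:R * (KA j * (K * r)).
have c0 j : 0 <= c j by rewrite !addr_ge0// !mulr_ge0.
have damp j := gflow_damped (S j) s1 (d_gt0 j) (tu j) (c0 j).
pose rj j := projT1 (cid2 (damp j)).
have rj0 j : 0 <= rj j by rewrite /rj; case: cid2.
have rjP j : forall y s a, `|s| <= s1 -> rj j < `|y| -> 0 <= a <= c j * (1 + `|y|) ->
    range (u j) (gflow (S j) (u j) y s * a) by rewrite /rj; case: cid2.
(* Above r, so the bounds on J persist when an index is added, and above every threshold, so an
   index that cannot be added is in the decay regime. *)
pose r' := r + \sum_j rj j.
have r'0 : 0 <= r' by rewrite addr_ge0// sumr_ge0.
have {}IH j : exists Rj : R, j \notin J -> forall x : 'rV[R]_k,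
    (forall i, i \in j |: J -> `|x *m A i| <= r') -> Rj < `|x| ->
    forall s, `|s| <= s1 -> - e < B (phi x s).
  have [jJ|jJ] := boolP (j \in J); first by exists 0.
  have [|Rj RjP] := IH (j |: J) _ r' r'0; last by exists Rj.
  rewrite -ltnS (leq_trans _ Jm)// ltnS proper_card// properE finset.setCS finset.subsetUr/=.
  by rewrite finset.setCS finset.subUset finset.sub1set (negbTE jJ).
have [Rj RjP] := choice IH.
(* The sum covers the cases where an index is added to J; the other two terms ensure |x - z| > R0
   when none is. *)
exists (\sum_j `|Rj j| + `|R0| + K * r) => x xr xR s ss1.
have [/existsP[j /andP[jJ xj]]|] := boolP [exists j, (j \notin J) && (`|x *m A j| <= r')].
  apply: (RjP j jJ x) => //.
    move=> i; rewrite !inE => /predU1P[->//|iJ].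
    by rewrite (le_trans (xr i iJ))// lerDl sumr_ge0.
  rewrite (le_lt_trans _ xR)// (le_trans (ler_norm _))// -addrA (bigD1 j)//= -addrA.
  by rewrite lerDl !addr_ge0// ?sumr_ge0// mulr_ge0.
rewrite negb_exists => /forallP far.
have [z zK zJ] := lift x r r0 xr.
have enz j : 1 + enorm ((x - z) *m A j) <= c j * (1 + `|x *m A j|).
  have h1 := enorm_le_norm ((x - z) *m A j).
  have h2 : `|(x - z) *m A j| <= `|x *m A j| + KA j * (K * r).
    rewrite mulmxBl (le_trans (ler_normB _ _))// lerD2l (le_trans (AK _ _))//.
    by rewrite ler_wpM2l.
  have h3 : (d j)%:R * `|(x - z) *m A j| <= (d j)%:R * (`|x *m A j| + KA j * (K * r)).
    by rewrite ler_wpM2l.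
  have q0 : 0 <= (d j)%:R * (KA j * (K * r)) by rewrite !mulr_ge0.
  have a0 := normr_ge0 (x *m A j).
  have qa := mulr_ge0 q0 a0.
  have n0 : 0 <= (d j)%:R :> R by [].
  rewrite /c; lra.
(* The flow at x is w damped at the shifted point x - z. Its coordinates lie in the ranges of the
   u_j: for j in J the factor is 1, and for the others the decay of the flow absorbs it. *)
pose w : 'rV[R]_n := \row_j (phi x s 0 j * (1 + enorm ((x - z) *m A j))).
have en1 j : 0 < 1 + enorm ((x - z) *m A j) by rewrite ltr_pwDl// enorm_ge0.
have -> : phi x s = \row_j (w 0 j / (1 + enorm ((x - z) *m A j))).
  by apply/rowP => j; rewrite !mxE mulfK// gt_eqF.
apply: R0P.
  have h1 : `|x| <= `|x - z| + `|z| by rewrite -[x in leLHS](subrK z) ler_normD.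
  have := norm_le_enorm (x - z); have := ler_norm R0.
  have : 0 <= \sum_j `|Rj j| by apply: sumr_ge0.
  move: xR zK h1; lra.
move=> j; rewrite mxE; have [jJ|jJ] := boolP (j \in J).
  have -> : 1 + enorm ((x - z) *m A j) = 1.
    rewrite zJ// /enorm big1 ?sqrtr0 ?addr0// => i _.
    by rewrite mxE expr0n.
  by rewrite mulr1; exact: phi_range.
rewrite mxE; apply: rjP => //; last by rewrite ltW//= enz.
have := far j; rewrite jJ /= -ltNge; apply: le_lt_trans.
by rewrite /r' (bigD1 j)//= addrCA lerDl addr_ge0// sumr_ge0.
Qed.

(** * Derivatives of the flow along lines and in time *)

Let D1 j (xi x : 'rV[R]_k) (s : R) :=
  \sum_p (xi *m A j) 0 p * gflow (S j) (partial p (u j)) (x *m A j) s.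

Let D2 j (xi x : 'rV[R]_k) (s : R) :=
  \sum_p (xi *m A j) 0 p *
    \sum_q (xi *m A j) 0 q * gflow (S j) (partial q (partial p (u j))) (x *m A j) s.

Let heat j (x : 'rV[R]_k) (s : R) :=
  \sum_p \sum_q ((A j)^T *m C *m A j) p q *
    gflow (S j) (partial q (partial p (u j))) (x *m A j) s.

Let is_derive_phi_line j (x xi : 'rV[R]_k) (s r : R) :
  is_derive r 1 (fun t : R => phi (x + t *: xi) s 0 j) (D1 j xi (x + r *: xi) s).
Proof.
have lineA (t : R) : (x + t *: xi) *m A j = x *m A j + t *: (xi *m A j).
  by rewrite mulmxDl scalemxAl.
under eq_fun do rewrite mxE lineA.
by rewrite /D1; under eq_bigr do rewrite lineA; exact: gflow_line.
Qed.

Let is_derive_D1_line j (x xi : 'rV[R]_k) (s r : R) :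
  is_derive r 1 (fun t : R => D1 j xi (x + t *: xi) s) (D2 j xi (x + r *: xi) s).
Proof.
have lineA (t : R) : (x + t *: xi) *m A j = x *m A j + t *: (xi *m A j).
  by rewrite mulmxDl scalemxAl.
have dg p := gflow_line (S j) (x *m A j) (xi *m A j) s r (test_fun_partial p (tu j)).
have := is_derive_sum (fun p => is_deriveZ ((xi *m A j) 0 p) (dg p)).
rewrite /D2; under [in X in _ -> X]eq_bigr do under eq_bigr do rewrite lineA.
rewrite (_ : (\sum_(p < d j) _ \*: _) = (fun t => D1 j xi (x + t *: xi) s))//.
by apply/funext => t; rewrite /D1 fct_sumE; apply: eq_bigr => p _; rewrite lineA.
Qed.

Let is_derive_phi_time j (x : 'rV[R]_k) (s : R) :
  is_derive s 1 (fun t => phi x t 0 j) (s * heat j x s).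
Proof.
under eq_fun do rewrite mxE.
have [[Ssym _] SS] := sqrtmxP (pdmx_psd (pdA j)).
have := gflow_time (S j) (x *m A j) s (tu j).
by rewrite [in X in X -> _]Ssym SS.
Qed.

(** Writing C = Q^T Q with Q = [sqrtmx C] gives A_j^T C A_j as the sum of (q A_j)^T (q A_j) over the
    rows q of Q. *)
Let sum_rows_D2 j (x : 'rV[R]_k) (s : R) :
  \sum_q D2 j (row q (sqrtmx C)) x s = heat j x s.
Proof.
have [[Qsym _] QQ] := sqrtmxP psdC; set Q := sqrtmx C in Qsym QQ *.
have ME p r : ((A j)^T *m C *m A j) p r = \sum_q (Q *m A j) q p * (Q *m A j) q r.
  rewrite -QQ -{1}Qsym !mulmxA -trmx_mul -mulmxA mxE.
  by apply: eq_bigr => q _; rewrite mxE.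
rewrite /D2 /heat exchange_big/=; apply: eq_bigr => p _.
under eq_bigr do rewrite mulr_sumr.
rewrite exchange_big/=; apply: eq_bigr => r _.
rewrite ME mulr_suml; apply: eq_bigr => q _.
by rewrite -!row_mul !mxE mulrA.
Qed.

(* Second derivatives are taken along the rows of sqrtmx C: their sum turns the
   quadratic forms of the directional derivatives into heat and hess_form. *)
Lemma spatial_min_heat (x : 'rV[R]_k) (s : R) :
  (forall v : 'rV[R]_n, box I v ->
     nsdmx (proj_ker (grad_mx A B v) *m hess_form A C B v *m proj_ker (grad_mx A B v))) ->
  (forall y, B (phi x s) <= B (phi y s)) ->
  0 <= \sum_j heat j x s * partial j B (phi x s).
Proof.
move=> hess xmin; pose Q := sqrtmx C.
pose G j : 'rV[R]_(d j) := \row_p gflow (S j) (partial p (u j)) (x *m A j) s.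
have D1E j xi : D1 j xi x s = (xi *m A j *m (G j)^T) 0 0.
  by rewrite /D1 [RHS]mxE; apply: eq_bigr => p _; rewrite !mxE.
have second xi : \sum_j D1 j xi x s * partial j B (phi x s) = 0 /\
    0 <= \sum_j (D2 j xi x s * partial j B (phi x s) +
      D1 j xi x s * \sum_i D1 i xi x s * partial i (partial j B) (phi x s)).
  have x0 : x + 0 *: xi = x by rewrite scale0r addr0.
  have d1 (t : R) : is_derive t 1 (fun r : R => B (phi (x + r *: xi) s))
      (\sum_j D1 j xi (x + t *: xi) s * partial j B (phi (x + t *: xi) s)).
    have := @is_derive_partialsB [::] (fun r => phi (x + r *: xi) s) t
      (\row_j D1 j xi (x + t *: xi) s) (phi_box _ _).
    under [in X in (_ -> X) -> _]eq_bigr do rewrite mxE.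
    by apply => j; rewrite mxE; exact: is_derive_phi_line.
  have dB j : is_derive (0 : R) 1 (fun r : R => partial j B (phi (x + r *: xi) s))
      (\sum_i D1 i xi x s * partial i (partial j B) (phi x s)).
    have := @is_derive_partialsB [:: j] (fun r => phi (x + r *: xi) s) 0
      (\row_i D1 i xi x s) (phi_box _ _).
    rewrite x0; under [in X in (_ -> X) -> _]eq_bigr do rewrite mxE.
    by apply => i; rewrite mxE -[X in D1 i xi X]x0; exact: is_derive_phi_line.
  have d2 : is_derive (0 : R) 1
      (fun t : R => \sum_j D1 j xi (x + t *: xi) s * partial j B (phi (x + t *: xi) s))
      (\sum_j (D2 j xi x s * partial j B (phi x s) +
        D1 j xi x s * \sum_i D1 i xi x s * partial i (partial j B) (phi x s))).
    have dj j := is_deriveM (is_derive_D1_line j x xi s 0) (dB j).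
    have := is_derive_sum dj.
    rewrite (_ : \sum_(j < n) _ = (fun t : R => \sum_j D1 j xi (x + t *: xi) s *
      partial j B (phi (x + t *: xi) s))); last by apply/funext => t; rewrite fct_sumE.
    move=> /is_derive_eq; apply; apply: eq_bigr => j _.
    by rewrite /= !x0 /GRing.scale/= addrC [X in X + _]mulrC.
  have [|e1 e2] := global_min_derive d1 d2.
    by move=> r; rewrite x0; exact: xmin.
  by rewrite x0 in e1; split; [exact: e1 | exact: e2].
pose w := \mxrow_j G j.
(* Coordinate i of T w^T is the derivative of B(phi) along the i-th basis vector, which vanishes at
   the minimum. *)
have Tw : grad_mx A B (phi x s) *m w^T = 0.
  rewrite /grad_mx /w tr_mxrow mul_mxrow_mxcol.
  apply/matrixP => i b; rewrite ord1 [RHS]mxE summxE.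
  have [e1 _] := second (delta_mx 0 i); rewrite -[RHS]e1; apply: eq_bigr => j _.
  by rewrite -scalemxAl mxE mulrC D1E -mulmxA -rowE [in RHS]mxE.
have := proj_ker_quad_le0 Tw (hess _ (phi_box x s)).
have -> : (w *m hess_form A C B (phi x s) *m w^T) 0 0 =
    \sum_q \sum_j D1 j (row q Q) x s *
      \sum_i D1 i (row q Q) x s * partial i (partial j B) (phi x s).
  rewrite /w /hess_form tr_mxrow mul_mxrow_mxblock mul_mxrow_mxcol summxE.
  rewrite [RHS]exchange_big/=; apply: eq_bigr => j _.
  under [RHS]eq_bigr do rewrite mulr_sumr.
  rewrite [RHS]exchange_big/= mulmx_suml summxE; apply: eq_bigr => i _.
  rewrite -scalemxAr -scalemxAl mxE.
  have [[Qsym _] QQ] := sqrtmxP psdC.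
  have -> : G i *m ((A i)^T *m C *m A j) *m (G j)^T =
      (Q *m A i *m (G i)^T)^T *m (Q *m A j *m (G j)^T).
    by rewrite !trmx_mul trmxK Qsym -[X in (A i)^T *m X *m A j]QQ !mulmxA.
  rewrite [in LHS]mxE mulr_sumr; apply: eq_bigr => q _.
  by rewrite !D1E -!row_mul !mxE; ring.
move=> le0.
(* The second derivatives along the rows of Q sum to the heat term plus the quadratic form bounded
   by [le0], so the heat term alone is nonnegative. *)
have : 0 <= \sum_q \sum_j (D2 j (row q Q) x s * partial j B (phi x s) +
    D1 j (row q Q) x s * \sum_i D1 i (row q Q) x s * partial i (partial j B) (phi x s)).
  by apply: sumr_ge0 => q _; have [] := second (row q Q).
under eq_bigr do rewrite big_split/=.
rewrite big_split/= => ge0.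
have : 0 <= \sum_q \sum_j D2 j (row q Q) x s * partial j B (phi x s).
  by rewrite (le_trans ge0)// gerDl.
rewrite exchange_big/=; under eq_bigr do rewrite -mulr_suml sum_rows_D2.
by [].
Qed.

Lemma heat_flow_ge0 :
  (forall v : 'rV[R]_n, box I v ->
     nsdmx (proj_ker (grad_mx A B v) *m hess_form A C B v *m proj_ker (grad_mx A B v))) ->
  (0 <= limf_einf (damped_inf A B u) (@at_infty R k))%E ->
  (forall x : 'rV[R]_k, 0 <= B (heat_flow A C u 0 x)) ->
  forall (t : R) (x : 'rV[R]_k), 0 <= t -> 0 <= B (heat_flow A C u t x).
Proof.
move=> hess liminf heat0_ge0 t x1 t_ge0; rewrite heat_flowE//.
have B0 x : 0 <= B (phi x 0).
  by have := heat0_ge0 x; rewrite heat_flowE// mulr0 sqrtr0.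
have : 0 <= Num.sqrt (2 * t) by exact: sqrtr_ge0.
move: (Num.sqrt _) => s1 s1_ge0; rewrite leNgt; apply/negP => neg.
have s1_gt0 : 0 < s1.
  by rewrite lt_neqAle s1_ge0 andbT eq_sym; apply: contraTneq neg => ->; rewrite -leNgt.
(* With this slope, B(phi) + e s at (x1, s1) is half of B(phi x1 s1), hence still negative. *)
pose e := - B (phi x1 s1) / (2 * s1).
have e_gt0 : 0 < e by rewrite divr_gt0 ?oppr_gt0 ?mulr_gt0.
have es1 : e * s1 = - B (phi x1 s1) / 2 by rewrite /e; field; rewrite gt_eqF.
(* For the empty set J no x A_j is assumed bounded, so the radius serves for all x. *)
have [|R1 R1P] := @phi_at_infinity (- B (phi x1 s1) / 2) s1 liminf _ finset.set0 0 (lexx 0).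
  by rewrite divr_gt0// oppr_gt0.
pose r := Num.max R1 `|x1|.
pose K : set ('rV[R]_k * R) := [set x | `|x| <= r] `*` `[0, s1].
pose f (xs : 'rV[R]_k * R) := B (phi xs.1 xs.2) + e * xs.2.
have Kx1 : K (x1, s1).
  by split; rewrite /= ?in_itv/= ?s1_ge0 ?lexx// le_max lexx orbT.
have cK : compact K by apply: compact_setX; [exact: compact_norm_ball | exact: segment_compact].
have cf : {within K, continuous f}.
  apply: continuous_subspaceT => xs.
  apply: cvgD; first exact: continuous_phi_pair.
  by apply: cvgMr; exact: cvg_snd.
have [[x0 s0] /set_mem[_ Ks0] fmin] := compact_EVT_min (ex_intro _ _ Kx1) cK cf.
have {Ks0} /andP[s0_ge0 s0_le] : 0 <= s0 <= s1 by move: Ks0; rewrite /= in_itv.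
(* Beyond the ball B(phi) exceeds half of B(phi x1 s1), which is the value of f at (x1, s1), so the
   minimum over K is one over all of space. *)
have gmin y s : 0 <= s <= s1 -> f (x0, s0) <= f (y, s).
  move=> /andP[s_ge0 s_le]; have [yr|yr] := leP `|y| r.
    by apply: fmin; rewrite inE; split; rewrite //= in_itv/= s_ge0.
  have fx1 : f (x0, s0) <= f (x1, s1) by apply: fmin; rewrite inE.
  rewrite (le_trans fx1)// /f/= es1.
  have : - (- B (phi x1 s1) / 2) < B (phi y s).
    apply: R1P; first by move=> j; rewrite finset.in_set0.
      by rewrite (le_lt_trans _ yr)// le_max lexx.
    by rewrite ger0_norm.
  by have := mulr_ge0 (ltW e_gt0) s_ge0; lra.
have f0_lt0 : f (x0, s0) < 0.
  have := gmin x1 s1; rewrite s1_ge0 lexx => /(_ isT).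
  by rewrite {2}/f/= es1; lra.
(* At s = 0 the function f reduces to the initial value of B(phi), which is nonnegative. *)
have s0_gt0 : 0 < s0.
  rewrite lt_neqAle s0_ge0 andbT eq_sym; apply: contraTneq f0_lt0 => ->.
  by rewrite /f/= mulr0 addr0 -leNgt.
have heat_ge0 : 0 <= \sum_j heat j x0 s0 * partial j B (phi x0 s0).
  apply: spatial_min_heat => // y.
  by have := gmin y s0; rewrite s0_ge0 s0_le => /(_ isT); rewrite /f/= lerD2r.
have df : is_derive s0 1 (fun s : R => f (x0, s))
    (s0 * (\sum_j heat j x0 s0 * partial j B (phi x0 s0)) + e).
  have dB := @is_derive_partialsB [::] (fun s => phi x0 s) s0
    (\row_j (s0 * heat j x0 s0)) (phi_box _ _).
  have de : is_derive s0 1 (fun s : R => e * s) e.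
    by have := is_deriveZ e (is_derive_id s0 (1 : R)); rewrite /GRing.scale/= mulr1.
  have /dB dB' j : is_derive s0 1 (fun s => phi x0 s 0 j)
      ((\row_j (s0 * heat j x0 s0)) 0 j) by rewrite mxE; exact: is_derive_phi_time.
  have := is_deriveD dB' de => /is_derive_eq; apply; congr (_ + _).
  by rewrite mulr_sumr; apply: eq_bigr => j _; rewrite mxE mulrA.
have : s0 * (\sum_j heat j x0 s0 * partial j B (phi x0 s0)) + e <= 0.
  apply: left_min_derive s0_gt0 df _ => s /andP[s_ge0 s_le].
  by apply: gmin; rewrite s_ge0 (le_trans s_le).
by apply/negP; rewrite -ltNge ltr_wpDl// mulr_ge0.
Qed.

End min_principle.

Theorem theorem4 (R : realType) (n k : nat) (d : 'I_n -> nat)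
    (n_gt0 : (0 < n)%N) (k_gt0 : (0 < k)%N) (d_gt0 : forall j, (0 < d j)%N)
    (A : forall j, 'M[R]_(k, d j))
    (I : 'I_n -> interval R) (B : 'rV[R]_n -> R) (C : 'M[R]_k)
    (u : forall j, 'rV[R]_(d j) -> R) :
  smooth_on (box I) B ->
  psdmx C ->
  (forall j, pdmx ((A j)^T *m C *m A j)) ->
  (forall j, smooth_on setT (u j)) ->
  (forall j, compactly_supported (u j)) ->
  (forall x : 'rV[R]_k, box I (\row_j u j (x *m A j))) ->
  (forall v : 'rV[R]_n, box I v ->
     let P := proj_ker (grad_mx A B v) in
     nsdmx (P *m hess_form A C B v *m P)) ->
  (0 <= limf_einf (damped_inf A B u) (@at_infty R k))%E ->
  (forall x : 'rV[R]_k, 0 <= B (heat_flow A C u 0 x)) ->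
  forall (t : R) (x : 'rV[R]_k), 0 <= t -> 0 <= B (heat_flow A C u t x).
Proof.
move=> smoothB psdC pdA smoothu csu u_box hess liminf B0 t x t0.
have tu j : test_fun (u j) by split.
exact: heat_flow_ge0 smoothB psdC pdA tu u_box hess liminf B0 t x t0.
Qed.
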